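(* Let $X\subset(\mathbb{C}^* )^n$ be an algebraic subvariety of codimension $k$. Then one can choose nonzero Laurent polynomials $P_1,\dots,P_k$ vanishing on $X$ such that any convenient compactification for the system $P_1=\dots=P_k=0$ is a good compactification for $X$. Moreover, for any ideal $I\subset\mathcal{L}_n$ defining $X$ (i.e. whose zero set in $(\mathbb{C}^* )^n$ is $X$) one can choose such Laurent polynomials $P_1,\dots,P_k$ from the ideal $I$.
   Context: $\mathcal{L}_n$ is the ring of Laurent polynomials in $n$ variables over $\mathbb{C}$, i.e. the ring of regular functions on the complex torus $(\mathbb{C}^* )^n$. Varieties may be reducible; the codimension of $X\subset(\mathbb{C}^* )^n$ is $n-\dim X$. The Newton polyhedron $\Delta(P)\subset\mathbb{R}^n$ of a nonzero Laurent polynomial $P$ is the convex hull of the exponents of the monomials appearing in $P$ with nonzero coefficient. The support function of a convex polyhedron $\Delta\subset\mathbb{R}^n$ is the function $H_\Delta(\xi)=\min_{x\in\Delta}\langle\xi,x\rangle$ on $(\mathbb{R}^n)^*$. A toric compactification of $(\mathbb{C}^* )^n$ is a complete (normal) toric variety $M\supset(\mathbb{C}^* )^n$, given by a complete fan $\mathcal{F}_M$ in $(\mathbb{R}^n)^*$. It is convenient for the system $P_1=\dots=P_k=0$ if the support functions of $\Delta(P_1),\dots,\Delta(P_k)$ are linear on each cone $\sigma\in\mathcal{F}_M$. A complete toric variety $M\supset(\mathbb{C}^* )^n$ is a good compactification for an algebraic variety $X\subset(\mathbb{C}^* )^n$ of codimension $k$ if the closure of $X$ in $M$ does not intersect any orbit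 of the $(\mathbb{C}^* )^n$-action on $M$ whose dimension is smaller than $k$. *)

(* Defs.v *)
(* The field of complex numbers is R[i], for an arbitrary R : realType. *)
From HB Require Import structures.
From mathcomp Require Import all_boot all_order all_algebra.
From mathcomp Require Import finmap.
From mathcomp Require Import boolp classical_sets cardinality reals complex.
From mathcomp Require Import monalg.

Set Implicit Arguments.
Unset Strict Implicit.
Unset Printing Implicit Defensive.

Import Order.TTheory GRing.Theory Num.Theory.

Local Open Scope classical_set_scope.
Local Open Scope ring_scope.

(* [monalg] puts a product on {malg C[K]} only when K has no nontrivial
   units, which excludes the exponent lattice 'rV[int]_n; hence the alias and
   the ring structure below. *)
Definition laurent (C : comNzRingType) (n : nat) : Type :=
  {malg C['rV[int]_n]}.

Section LaurentRing.
Variables (C : comNzRingType) (n : nat).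
Local Notation L := (laurent C n).
Implicit Types (f g h : {malg C['rV[int]_n]}) (a b : 'rV[int]_n) (c d : C).

HB.instance Definition _ := GRing.Zmodule.on L.

Definition laurent_mul f g : {malg C['rV[int]_n]} :=
  \sum_(a <- msupp f) \sum_(b <- msupp g) << f@_a * g@_b *g a + b >>.

Definition laurent_one : {malg C['rV[int]_n]} := << 1 *g 0 >>.

Fact laurent_mulw (d1 d2 : {fset 'rV[int]_n}) f g :
    fsubset (msupp f) d1 -> fsubset (msupp g) d2 ->
  laurent_mul f g = \sum_(a <- d1) \sum_(b <- d2) << f@_a * g@_b *g a + b >>.
Proof.
move=> le1 le2; rewrite /laurent_mul (big_fset_incl _ le1) /=.
  apply/eq_bigr => a _; apply/big_fset_incl => // b _ /mcoeff_outdom ->.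
  by rewrite mulr0 monalgU0.
move=> a _ /mcoeff_outdom fa; rewrite big1 // => b _.
by rewrite fa mul0r monalgU0.
Qed.

Fact laurent_mulC : commutative laurent_mul.
Proof.
move=> f g; rewrite /laurent_mul exchange_big /=.
by apply/eq_bigr => a _; apply/eq_bigr => b _; rewrite mulrC addrC.
Qed.

Fact laurent_mulDl : left_distributive laurent_mul +%R.
Proof.
move=> f g h.
pose D := fsetU (msupp f) (msupp g).
rewrite (@laurent_mulw D (msupp h) (f + g)) ?msuppD_le //.
rewrite (@laurent_mulw D (msupp h) f) ?fsubsetUl //.
rewrite (@laurent_mulw D (msupp h) g) ?fsubsetUr //.
rewrite -big_split /=; apply/eq_bigr => a _.
rewrite -big_split /=; apply/eq_bigr => b _.
by rewrite mcoeffD mulrDl monalgUD.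
Qed.

Fact laurent_mulDr : right_distributive laurent_mul +%R.
Proof. by move=> f g h; rewrite !(laurent_mulC f) laurent_mulDl. Qed.

Fact laurent_mul0g : left_zero 0 laurent_mul.
Proof. by move=> f; rewrite /laurent_mul msupp0 big_seq_fset0. Qed.

Fact laurent_mulg0 : right_zero 0 laurent_mul.
Proof. by move=> f; rewrite laurent_mulC laurent_mul0g. Qed.

Fact laurent_mulUU c d a b :
  laurent_mul << c *g a >> << d *g b >> = << c * d *g a + b >>.
Proof.
by rewrite (laurent_mulw msuppU_le msuppU_le) !big_seq_fset1 !mcoeffUU.
Qed.

Fact laurent_mul_suml I (r : seq I) (F : I -> {malg C['rV[int]_n]}) g :
  laurent_mul (\sum_(i <- r) F i) g = \sum_(i <- r) laurent_mul (F i) g.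
Proof.
exact: (big_morph (laurent_mul^~ g) (fun _ _ => laurent_mulDl _ _ _)
  (laurent_mul0g _)).
Qed.

Fact laurent_mul_sumr I (r : seq I) (F : I -> {malg C['rV[int]_n]}) g :
  laurent_mul g (\sum_(i <- r) F i) = \sum_(i <- r) laurent_mul g (F i).
Proof.
exact: (big_morph (laurent_mul g) (fun _ _ => laurent_mulDr _ _ _)
  (laurent_mulg0 _)).
Qed.

Fact laurent_mulA : associative laurent_mul.
Proof.
move=> f g h; rewrite (monalgE f) (monalgE g) (monalgE h).
rewrite !laurent_mul_suml; apply/eq_bigr => a _.
rewrite !(@laurent_mul_sumr _ (msupp g)) laurent_mul_suml.
apply/eq_bigr => b _; rewrite !laurent_mul_sumr; apply/eq_bigr => c _.
by rewrite !laurent_mulUU mulrA addrA.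
Qed.

Fact laurent_mul1 : left_id laurent_one laurent_mul.
Proof.
move=> f; rewrite {1}(monalgE f) laurent_mul_sumr [RHS]monalgE.
by apply/eq_bigr => a _; rewrite laurent_mulUU mul1r add0r.
Qed.

Fact laurent_one_neq0 : laurent_one != 0.
Proof. by rewrite monalgU_eq0 oner_eq0. Qed.

HB.instance Definition _ := GRing.Zmodule_isComNzRing.Build L
  laurent_mulA laurent_mulC laurent_mul1 laurent_mulDl laurent_one_neq0.

End LaurentRing.

(* Unlike [idealr_closed], this allows the unit ideal. *)
Definition is_ideal (A : comNzRingType) (I : set A) : Prop :=
  I 0 /\ forall a u v, I u -> I v -> I (a * u + v).

(* In this section a topology on T is given by its family of closed sets. *)
Section KrullDimension.
Variables (T : Type) (closed : set (set T)).

Definition irreducible (Z : set T) : Prop :=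
  Z !=set0 /\
  forall A B, closed A -> closed B -> Z `<=` A `|` B -> Z `<=` A \/ Z `<=` B.

(* Z_0 < ... < Z_d, irreducible and closed in the subspace topology of S. *)
Definition irreducible_chain (S : set T) (d : nat) : Prop :=
  exists Z : nat -> set T,
    (forall j, (j <= d)%N ->
       irreducible (Z j) /\ exists2 A, closed A & Z j = S `&` A) /\
    (forall j, (j < d)%N -> Z j `<` Z j.+1).

(* The empty set has no dimension in this sense. *)
Definition has_dim (S : set T) (d : nat) : Prop :=
  irreducible_chain S d /\ forall e, irreducible_chain S e -> (e <= d)%N.

End KrullDimension.

Section Torus.
Variables (R : realType) (n : nat).
Local Notation C := R[i].

Definition torus : set 'rV[C]_n := [set t | forall i, t 0 i != 0].

Definition monomial (t : 'rV[C]_n) (m : 'rV[int]_n) : C :=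
  \prod_(i < n) t 0 i ^ m 0 i.

(* The linear extension of a function x on exponents: x m is the value given
   to the monomial of exponent m. *)
Definition eval (f : laurent C n) (x : 'rV[int]_n -> C) : C :=
  \sum_(m <- msupp f) f@_m * x m.

Definition zeros (E : set (laurent C n)) : set 'rV[C]_n :=
  [set t | torus t /\ forall f, E f -> eval f (monomial t) = 0].

Definition torus_closed (X : set 'rV[C]_n) : Prop := exists E, X = zeros E.

Definition has_codim (X : set 'rV[C]_n) (k : nat) : Prop :=
  exists2 d, has_dim torus_closed X d & (d + k)%N = n.

End Torus.

(* R^n is 'rV[R]_n and its dual is 'cV[R]_n. *)
Section Polyhedra.
Variables (R : realType) (n : nat).

Definition pairing (xi : 'cV[R]_n) (x : 'rV[R]_n) : R := (x *m xi) 0 0.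

Definition newton (P : laurent R[i] n) : set 'rV[R]_n :=
  [set x | exists w : 'rV[int]_n -> R,
     [/\ forall m, 0 <= w m, \sum_(m <- msupp P) w m = 1
       & x = \sum_(m <- msupp P) w m *: map_mx intr m]].

(* For a Newton polyhedron the infimum is a minimum: see [support_fun_min]. *)
Definition support_fun (D : set 'rV[R]_n) (xi : 'cV[R]_n) : R :=
  inf [set pairing xi x | x in D].

Definition linear_on (sigma : set 'cV[R]_n) (h : 'cV[R]_n -> R) : Prop :=
  exists x : 'rV[R]_n, forall xi, sigma xi -> h xi = pairing xi x.

Definition rational_cone (sigma : set 'cV[R]_n) : Prop :=
  exists (r : nat) (v : 'I_r -> 'cV[int]_n),
    sigma = [set xi | exists c : 'I_r -> R, (forall j, 0 <= c j) /\
                        xi = \sum_(j < r) c j *: map_mx intr (v j)].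

Definition strongly_convex (sigma : set 'cV[R]_n) : Prop :=
  forall xi, sigma xi -> sigma (- xi) -> xi = 0.

Definition face (tau sigma : set 'cV[R]_n) : Prop :=
  exists u : 'rV[R]_n, (forall xi, sigma xi -> 0 <= pairing xi u) /\
    tau = sigma `&` [set xi | pairing xi u = 0].

Record is_fan (F : set (set 'cV[R]_n)) : Prop := IsFan {
  fan_finite : finite_set F;
  fan_rational : forall sigma, F sigma -> rational_cone sigma;
  fan_pointed : forall sigma, F sigma -> strongly_convex sigma;
  fan_face : forall sigma tau, F sigma -> face tau sigma -> F tau;
  fan_meet : forall sigma tau, F sigma -> F tau ->
    face (sigma `&` tau) sigma /\ face (sigma `&` tau) tau }.

Definition complete_fan (F : set (set 'cV[R]_n)) : Prop :=
  is_fan F /\ \bigcup_(sigma in F) sigma = setT.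

Definition convenient (F : set (set 'cV[R]_n)) (k : nat)
    (P : 'I_k -> laurent R[i] n) : Prop :=
  forall i sigma, F sigma -> linear_on sigma (support_fun (newton (P i))).

Fact pairing_sum (I : eqType) (r : seq I) (w : I -> R) (x : I -> 'rV[R]_n)
    (xi : 'cV[R]_n) :
  pairing xi (\sum_(i <- r) w i *: x i) = \sum_(i <- r) w i * pairing xi (x i).
Proof.
rewrite /pairing mulmx_suml summxE; apply: eq_bigr => i _.
by rewrite -scalemxAl mxE.
Qed.

Fact seq_argmin (I : eqType) (r : seq I) (h : I -> R) : r != [::] ->
  exists2 i, i \in r & forall j, j \in r -> h i <= h j.
Proof.
elim: r => // a r IH _; have [->|/IH[i ir hi]] := eqVneq r [::].
  by exists a => [|j]; rewrite inE // => /eqP ->.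
have [ai|/ltW ia] := leP (h a) (h i).
  exists a => [|j]; rewrite inE ?eqxx // => /orP[/eqP -> //|jr].
  exact: le_trans ai (hi j jr).
exists i => [|j]; rewrite inE ?ir ?orbT // => /orP[/eqP -> //|]; exact: hi.
Qed.

Lemma support_fun_min (P : laurent R[i] n) (xi : 'cV[R]_n) : P != 0 ->
  (exists2 x, newton P x & pairing xi x = support_fun (newton P) xi) /\
  (forall x, newton P x -> support_fun (newton P) xi <= pairing xi x).
Proof.
move=> P0; pose h (m : 'rV[int]_n) := pairing xi (map_mx intr m).
have [|m0 m0P m0min] := @seq_argmin _ (msupp P) h.
  apply: contraNneq P0 => P0; rewrite (monalgE P) P0 big_nil; exact: eqxx.
have lbP x : newton P x -> h m0 <= pairing xi x.
  move=> [w [w0 w1 ->]]; rewrite pairing_sum -[leLHS]mul1r -[X in X * h m0]w1 mulr_suml.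
  rewrite big_seq_cond [leRHS]big_seq_cond.
  apply: ler_sum => m /andP[mP _].
  by apply: ler_wpM2l; [exact: w0|exact: m0min].
have newt0 : newton P (map_mx intr m0).
  exists (fun m => (m == m0)%:R); split => [m||]; first exact: ler0n.
    rewrite (big_fsetD1 m0) //= eqxx big1_fset ?addr0 // => m.
    by rewrite in_fsetD1 => /andP[/negPf -> _].
  rewrite (big_fsetD1 m0) //= eqxx scale1r big1_fset ?addr0 // => m.
  by rewrite in_fsetD1 => /andP[/negPf -> _]; rewrite scale0r.
have lb0 : lbound [set pairing xi x | x in newton P] (h m0).
  by move=> _ [x xP <-]; exact: lbP.
have infE : support_fun (newton P) xi = h m0.
  apply/eqP; rewrite eq_le; apply/andP; split.
    by apply: ge_inf; [exists (h m0)|exists (map_mx intr m0)].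
  by apply: lb_le_inf => //; exists (h m0); exists (map_mx intr m0).
by rewrite infE; split => //; exists (map_mx intr m0).
Qed.

End Polyhedra.

(* The toric variety of a fan F, glued from the affine charts U_sigma.  A
   C-point of U_sigma = Spec C[S_sigma] is a morphism from S_sigma to the
   multiplicative monoid C, encoded as a function on all exponents that
   vanishes off S_sigma.  A point of the toric variety is a gluing class of pairs (sigma, x) with sigma
   in F and x in U_sigma, where U_sigma and U_tau are glued along their common
   open subset, the chart of sigma `&` tau. *)
Section ToricVariety.
Variables (R : realType) (n : nat).
Local Notation C := R[i].
Local Notation cone := (set 'cV[R]_n).
Local Notation chart_pt := (cone * ('rV[int]_n -> C))%type.

Definition dual_semigroup (sigma : cone) : set 'rV[int]_n :=
  [set m | forall xi, sigma xi -> 0 <= pairing xi (map_mx intr m)].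

Definition chart (sigma : cone) : set ('rV[int]_n -> C) :=
  [set x | [/\ x 0 = 1,
    forall a b, dual_semigroup sigma a -> dual_semigroup sigma b ->
      x (a + b) = x a * x b
    & forall m, ~ dual_semigroup sigma m -> x m = 0]].

(* The regular functions on U_sigma are the Laurent polynomials with exponents
   in S_sigma. *)
Definition chart_closed (sigma : cone) (Z : set ('rV[int]_n -> C)) : Prop :=
  exists2 E : set (laurent C n),
    forall f m, E f -> m \in msupp f -> dual_semigroup sigma m
    & Z = [set x | chart sigma x /\ forall f, E f -> eval f x = 0].

Definition glued (p q : chart_pt) : Prop :=
  exists2 y, chart (p.1 `&` q.1) y
    & (forall m, dual_semigroup p.1 m -> y m = p.2 m) /\
      (forall m, dual_semigroup q.1 m -> y m = q.2 m).

Definition toric_pt (F : set cone) (sigma : cone) (x : 'rV[int]_n -> C)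
  : set chart_pt :=
  [set q | [/\ F q.1, chart q.1 q.2 & glued (sigma, x) q]].

Definition toric_variety (F : set cone) : set (set chart_pt) :=
  [set p | exists sigma x, [/\ F sigma, chart sigma x
                             & p = toric_pt F sigma x]].

Definition toric_closed (F : set cone) (Z : set (set chart_pt)) : Prop :=
  Z `<=` toric_variety F /\
  forall sigma, F sigma ->
    chart_closed sigma [set x | chart sigma x /\ Z (toric_pt F sigma x)].

(* The torus is the chart of the zero cone. *)
Definition torus_emb (F : set cone) (t : 'rV[C]_n) : set chart_pt :=
  toric_pt F [set 0] (monomial t).

Definition torus_act (t : 'rV[C]_n) (p : set chart_pt) : set chart_pt :=
  [set (q.1, fun m => monomial t m * q.2 m) | q in p].

Definition orbit (p : set chart_pt) : set (set chart_pt) :=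
  [set torus_act t p | t in @torus R n].

Definition toric_closure (F : set cone) (X : set 'rV[C]_n)
  : set (set chart_pt) :=
  smallest (toric_closed F) (torus_emb F @` X).

Definition good_compactification (F : set cone) (X : set 'rV[C]_n) (k : nat)
  : Prop :=
  forall p d, toric_variety F p -> has_dim (toric_closed F) (orbit p) d ->
    (d < k)%N -> toric_closure F X `&` orbit p = set0.

End ToricVariety.

(* Main.v *)
(* Let w_l = (1, a_l, ..., a_l^(n-1)) be distinct points of the moment curve and
   W_q = {m : <m, w_l> = 0 for l < q}.  An ideal I whose zero set has dimension d
   contains a nonzero Laurent polynomial with exponents in W_q as soon as
   d + q < n: otherwise there is a chain of primes above I of length n - q, the
   j-th one meeting C[W_(q+j)] only in 0, and by the Nullstellensatz its zero
   sets form a chain of irreducible subsets that is too long.  Each step of this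
   chain, and the Nullstellensatz, rest on C being uncountable.  Hence one can
   pick P_0, ..., P_(k-1) in I and w_0, ..., w_(k-1) such that w_l vanishes on
   the exponents of P_i for l < i and is injective on them for l = i.

   In a convenient compactification a vertex u_i of the Newton polyhedron of P_i
   is attached to every cone.  If a point x of the closure of X lies in the
   chart of sigma, then x kills the regular function P_i / x^(u_i), so some
   exponent m_i of P_i other than u_i has x(m_i - u_i) <> 0.  The vectors
   e_i = m_i - u_i satisfy <e_i, w_l> = 0 for l < i and <e_i, w_i> <> 0, so the
   closures of the orbits of x under the subtori generated by the first j
   one-parameter groups w_0, ..., w_(j-1) increase strictly with j: they are
   separated by the divisors of the sections x^(m_j) - c x^(u_j).  The orbit of
   x therefore has dimension at least k. *)
Require Import Defs.
From HB Require Import structures.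
From mathcomp Require Import all_boot all_order all_algebra.
From mathcomp Require Import finmap.
From mathcomp Require Import boolp classical_sets cardinality reals complex.
From mathcomp Require Import monalg.
From mathcomp Require lebesgue_measure.

Set Implicit Arguments.
Unset Strict Implicit.
Unset Printing Implicit Defensive.

Import Order.TTheory GRing.Theory Num.Theory.

Local Open Scope classical_set_scope.
Local Open Scope ring_scope.

(** * Laurent polynomials and their values on the torus *)

Section Laurent.
Variables (R : realType) (n : nat).
Local Notation C := R[i].
Local Notation L := (laurent C n).
Implicit Types (f g h : L) (m a b : 'rV[int]_n) (c d : C) (t u : 'rV[C]_n).

Definition term c m : L := << c *g m >>.

Lemma laurentE f : f = \sum_(m <- msupp f) term f@_m m.
Proof. exact: (monalgE (f : {malg C['rV[int]_n]})). Qed.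

Lemma termM c d a b : term c a * term d b = term (c * d) (a + b).
Proof. exact: laurent_mulUU. Qed.

Lemma term1D a b : term 1 (a + b) = term 1 a * term 1 b.
Proof. by rewrite termM mul1r. Qed.

Lemma term10 : term 1 0 = 1 :> L.
Proof. by []. Qed.

Lemma evalw (D : {fset 'rV[int]_n}) f x : fsubset (msupp f) D ->
  eval f x = \sum_(m <- D) f@_m * x m.
Proof.
move=> fD; rewrite /eval (big_fset_incl _ fD) //= => m _ /mcoeff_outdom ->.
by rewrite mul0r.
Qed.

Lemma evalE f x : eval f x = \sum_(m <- msupp f) f@_m * x m.
Proof. by []. Qed.

Lemma evalD f g x : eval (f + g) x = eval f x + eval g x.
Proof.
pose D := fsetU (msupp f) (msupp g).
rewrite (@evalw D (f + g)); last exact: msuppD_le.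
rewrite (@evalw D f) ?fsubsetUl // (@evalw D g) ?fsubsetUr // -big_split /=.
by apply: eq_bigr => m _; rewrite (mcoeffD m f g) mulrDl.
Qed.

Lemma eval0 x : eval (0 : L) x = 0.
Proof. by rewrite (@evalw fset0) ?big_seq_fset0 // msupp0. Qed.

Lemma evalN f x : eval (- f) x = - eval f x.
Proof. by apply/eqP; rewrite -addr_eq0 -evalD addNr eval0. Qed.

Lemma evalB f g x : eval (f - g) x = eval f x - eval g x.
Proof. by rewrite evalD evalN. Qed.

Lemma eval_sum (I : Type) (r : seq I) (P : pred I) (F : I -> L) x :
  eval (\sum_(i <- r | P i) F i) x = \sum_(i <- r | P i) eval (F i) x.
Proof. exact: (big_morph (fun f => eval f x) (fun f g => evalD f g x) (eval0 x)). Qed.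

Lemma eval_term c m x : eval (term c m) x = c * x m.
Proof.
rewrite (@evalw [fset m]%fset); last exact: msuppU_le.
by rewrite big_seq_fset1 (mcoeffUU m c).
Qed.

Lemma monomialE t m : monomial t m = \prod_(i < n) t 0 i ^ m 0 i.
Proof. by []. Qed.

Lemma monomial0 t : monomial t 0 = 1.
Proof. by rewrite /monomial big1 // => i _; rewrite mxE expr0z. Qed.

Lemma monomialD t a b : torus t ->
  monomial t (a + b) = monomial t a * monomial t b.
Proof.
move=> t0; rewrite /monomial -big_split /=; apply: eq_bigr => i _.
by rewrite mxE expfzDr.
Qed.

Lemma monomial_neq0 t m : torus t -> monomial t m != 0.
Proof. by move=> t0; apply/prodf_neq0 => i _; apply: expfz_neq0. Qed.

Lemma evalM f g t : torus t ->
  eval (f * g) (monomial t) = eval f (monomial t) * eval g (monomial t).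
Proof.
move=> t0; rewrite [f in LHS]laurentE [g in LHS]laurentE mulr_suml eval_sum.
rewrite /eval mulr_suml; apply: eq_bigr => a _.
rewrite mulr_sumr [LHS]eval_sum mulr_sumr; apply: eq_bigr => b _.
by rewrite termM eval_term monomialD // mulrACA.
Qed.

Lemma eval1 t : eval (1 : L) (monomial t) = 1.
Proof. by rewrite (eval_term 1 0) monomial0 mulr1. Qed.

Lemma eval_prod (I : Type) (r : seq I) (P : pred I) (F : I -> L) t : torus t ->
  eval (\prod_(i <- r | P i) F i) (monomial t) =
  \prod_(i <- r | P i) eval (F i) (monomial t).
Proof.
move=> t0.
exact: (big_morph (fun f => eval f (monomial t)) (fun f g => evalM f g t0) (eval1 t)).
Qed.

Lemma torusM t u : torus t -> torus u -> torus (\row_i (t 0 i * u 0 i)).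
Proof. by move=> t0 u0 i; rewrite mxE mulf_neq0. Qed.

Lemma monomialM t u m :
  monomial (\row_i (t 0 i * u 0 i)) m = monomial t m * monomial u m.
Proof.
by rewrite /monomial -big_split /=; apply: eq_bigr => i _; rewrite mxE expfzMl.
Qed.

Lemma monomial_delta t i : monomial t (delta_mx 0 i) = t 0 i.
Proof.
rewrite /monomial (bigD1 i) //= mxE !eqxx expr1z big1 ?mulr1 // => j ji.
by rewrite mxE (negbTE ji) andbF expr0z.
Qed.

Lemma monomialN t a : torus t -> monomial t (- a) * monomial t a = 1.
Proof. by move=> t0; rewrite -monomialD // addNr monomial0. Qed.

Lemma monomialVM t m : torus t ->
  monomial (\row_i (t 0 i)^-1) m * monomial t m = 1.
Proof.
move=> t0; rewrite /monomial -big_split big1 //= => i _.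
by rewrite mxE -expfzMl mulVf ?exp1rz.
Qed.

Lemma monomial_prod (I : Type) (r : seq I) (P : pred I) (F : I -> 'rV[C]_n) m :
  monomial (\row_i \prod_(l <- r | P l) F l 0 i) m = \prod_(l <- r | P l) monomial (F l) m.
Proof.
rewrite /monomial exchange_big /=; apply: eq_bigr => i _; rewrite mxE.
by apply: (big_morph (fun z : C => z ^ m 0 i)) => [z w|]; [exact: expfzMl|exact: exp1rz].
Qed.

Lemma msupp_mul f g m : m \in msupp (f * g) ->
  exists a b, [/\ a \in msupp f, b \in msupp g & m = a + b].
Proof.
apply: contraPP => H; apply/negP; rewrite -mcoeff_eq0; apply/eqP.
pose co (h : L) := h@_m.
have coD : {morph co : u v / u + v} by move=> u v; exact: mcoeffD.
have co0 : co 0 = 0 by exact: mcoeff0.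
rewrite -/(co (f * g)) [f]laurentE mulr_suml (big_morph co coD co0).
rewrite big_seq big1 // => a af.
rewrite [g]laurentE mulr_sumr (big_morph co coD co0) big_seq big1 // => b bg.
rewrite termM; apply: (etrans (mcoeffU _ _ _)).
case: eqP => [e|_]; last by rewrite mulr0n.
by case: H; exists a, b.
Qed.

End Laurent.

Lemma nat_nonroot (A : numDomainType) (p : {poly A}) :
  p != 0 -> exists a : nat, p.[a%:R] != 0.
Proof.
move=> p0; apply: contrapT => /forallNP H.
suff /(max_poly_roots p0) :
    all (root p) [seq a%:R | a <- iota 0 (size p)].
  rewrite map_inj_in_uniq ?iota_uniq; first by move=> /(_ isT); rewrite size_map size_iota ltnn.
  by move=> a b _ _ /eqP; rewrite eqr_nat => /eqP.
apply/allP => _ /mapP[a _ ->].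
by apply/eqP/eqP/negPn/negP; exact: H.
Qed.

Lemma rV_int_ind (n : nat) (G : 'rV[int]_n -> Prop) : G 0 ->
  (forall a b, G a -> G b -> G (a + b)) -> (forall a, G a -> G (- a)) ->
  (forall i, G (delta_mx 0 i)) -> forall m, G m.
Proof.
move=> G0 GD GN Gdelta.
have Gnat m k : G m -> G (m *+ k).
  by move=> Gm; elim: k => [|k IH]; [rewrite mulr0n|rewrite mulrS; exact: GD].
have GZ (z : int) m : G m -> G (z *: m).
  move=> Gm; case: (intP z) => [|k|k]; first by rewrite scale0r.
    by rewrite -natz scaler_nat; exact: Gnat.
  by rewrite -natz scaleNr scaler_nat; apply: GN; exact: Gnat.
by move=> m; rewrite [m]row_sum_delta; apply: big_ind => // i _; exact: GZ.
Qed.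

(** * Weights given by points of the moment curve *)

Section Weight.
Variables (n : nat).
Implicit Types (m : 'rV[int]_n) (a : nat).

(** The pairing of [m] with the moment-curve point (1, a, ..., a^(n-1)), written as a polynomial
    value so that questions about weights become questions about roots. *)
Definition weight a m : int := (rVpoly m).[a%:R].

Lemma weightE a m : weight a m = \sum_(j < n) m 0 j * a%:R ^+ j.
Proof.
rewrite /weight (@horner_coef_wide _ n) ?size_poly //.
by apply: eq_bigr => j _; rewrite coef_rVpoly_ord.
Qed.

Lemma weight0 a : weight a 0 = 0.
Proof. by rewrite /weight linear0 horner0. Qed.

Lemma weightD a m m' : weight a (m + m') = weight a m + weight a m'.
Proof. by rewrite /weight linearD hornerD. Qed.

Lemma weightB a m m' : weight a (m - m') = weight a m - weight a m'.
Proof. by rewrite /weight linearB hornerD hornerN. Qed.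

(** Distinct exponents share a weight only at roots of the nonzero polynomial of their difference. A
    natural number that is no root of one product polynomial avoids all these coincidences and all
    of [bad]. *)
Lemma weight_separates (D : seq 'rV[int]_n) (bad : seq nat) :
  exists2 a, a \notin bad & {in D &, injective (weight a)}.
Proof.
pose p : {poly int} := \prod_(b <- bad) ('X - b%:R%:P) *
  \prod_(m <- D) \prod_(m' <- D | m' != m) rVpoly (m - m').
have p0 : p != 0.
  rewrite mulf_neq0 //; first by rewrite monic_neq0 // monic_prod_XsubC.
  rewrite prodf_seq_neq0; apply/allP => m _ /=.
  rewrite prodf_seq_neq0; apply/allP => m' _ /=; apply/implyP => m'm.
  apply: contraNneq m'm => /(congr1 (poly_rV (d := n))).
  by rewrite rVpolyK linear0 => /eqP; rewrite subr_eq0 eq_sym.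
have [a] := nat_nonroot p0.
rewrite hornerM mulf_eq0 negb_or !horner_prod => /andP[pa pD].
exists a.
  apply/negP => ab; move: pa; rewrite prodf_seq_neq0 => /allP /(_ _ ab) /=.
  by rewrite hornerXsubC subrr eqxx.
move=> m m' mD m'D /eqP; rewrite -subr_eq0 -weightB => w0.
apply/eqP/negPn/negP => mm'.
move: pD; rewrite prodf_seq_neq0 => /allP /(_ _ mD) /=.
rewrite horner_prod prodf_seq_neq0 => /allP /(_ _ m'D) /=.
by rewrite eq_sym mm' /= (negbTE (_ : ~~ ((rVpoly (m - m')).[a%:R] != 0))) // negbK.
Qed.

(* The witness is the coefficient vector of the product of the X - a l, l < q. *)
Lemma weight_dual (a : nat -> nat) (q : nat) : injective a -> (q < n)%N ->
  exists m, (forall l, (l < q)%N -> weight (a l) m = 0) /\ weight (a q) m != 0.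
Proof.
move=> a_inj qn; pose p : {poly int} := \prod_(l < q) ('X - (a l)%:R%:P).
exists (poly_rV p); rewrite /weight poly_rV_K; last first.
  by rewrite size_prod_XsubC /index_enum -enumT size_enum_ord.
split=> [l lq|].
  by rewrite horner_prod (bigD1 (Ordinal lq)) //= hornerXsubC subrr mul0r.
rewrite horner_prod; apply/prodf_neq0 => l _.
rewrite hornerXsubC subr_eq0 eqr_nat; apply/negP => /eqP /a_inj e.
by have := ltn_ord l; rewrite -e ltnn.
Qed.

End Weight.

(** * One-parameter subgroups and nonvanishing points *)

Section OneParam.
Variables (R : realType) (n : nat).
Local Notation C := R[i].
Local Notation L := (laurent C n).
Implicit Types (f g h : L) (m : 'rV[int]_n) (s : C) (a : nat).

Definition oneparam a s : 'rV[C]_n := \row_j s ^ (a%:R ^+ j : int).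

Lemma torus_oneparam a s : s != 0 -> torus (oneparam a s).
Proof. by move=> s0 i; rewrite mxE expfz_neq0. Qed.

Lemma monomial_oneparam a s m : s != 0 -> monomial (oneparam a s) m = s ^ weight a m.
Proof.
move=> s0; rewrite weightE.
have sD : {morph (fun z : int => s ^ z) : x y / x + y >-> x * y}.
  by move=> x y; rewrite expfzDr.
rewrite (big_morph _ sD (expr0z s)); apply: eq_bigr => j _.
by rewrite mxE exprz_exp mulrC.
Qed.

(** Since the weights are distinct, no two monomials of [f] merge along the one-parameter group, so
    [f] restricts to a nonzero Laurent polynomial in [s]; [p] is that restriction times a power of
    [s]. *)
Lemma oneparam_poly (D : seq 'rV[int]_n) a f :
  {in D &, injective (weight a)} -> {subset msupp f <= D} -> f != 0 ->
  exists2 p : {poly C}, p != 0 &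
    forall s, s != 0 -> p.[s] != 0 -> eval f (monomial (oneparam a s)) != 0.
Proof.
move=> a_inj fD f0.
(* [N] bounds all absolute weights on [D], so that the shifted exponents [N + weight a m] are
   natural numbers. *)
pose N : nat := \sum_(m <- D) `|weight a m|%N.
pose e m := absz (N%:Z + weight a m).
have eE m : m \in D -> (e m)%:Z = N%:Z + weight a m.
  move=> mD; rewrite /e gez0_abs // -lerBlDr sub0r.
  rewrite (le_trans (ler_norm _)) // normrN -abszE lez_nat /N.
  by rewrite (big_rem m) //= leq_addr.
have e_inj : {in D &, injective e}.
  move=> m m' mD m'D /(congr1 Posz); rewrite !eE // => /addrI; exact: a_inj.
exists (\sum_(m <- msupp f) f@_m *: 'X^(e m)).
  have [m0 m0f] : exists m, m \in msupp f.
    apply/fset0Pn; apply: contraNneq f0 => supp0.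
    by rewrite [f]laurentE supp0 big_seq_fset0.
  apply/eqP => /(congr1 (fun p : {poly C} => p`_(e m0))).
  rewrite coef0 coef_sum (big_fsetD1 m0) //= coefZ coefXn eqxx mulr1.
  rewrite big_seq big1 ?addr0 => [/eqP|m]; first by rewrite mcoeff_eq0 m0f.
  rewrite in_fsetD1 => /andP[mm0 mf]; rewrite coefZ coefXn eq_sym.
  case: eqP; rewrite ?mulr0 // => /e_inj H.
  by rewrite H ?eqxx // in mm0; apply: fD.
move=> s s0; apply: contra_neq; rewrite horner_sum => f_s.
rewrite -[RHS](mulr0 (s ^+ N)) -[X in _ * X]f_s /eval mulr_sumr.
rewrite big_seq [RHS]big_seq; apply: eq_bigr => m mf.
rewrite hornerZ hornerXn monomial_oneparam // mulrCA; congr (_ * _).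
by rewrite !exprnP -expfzDr // eE // fD.
Qed.

(** One weight separating the exponents of both reduces the claim to a nonroot of a product of
    nonzero polynomials in one variable; the factor ['X] keeps the parameter nonzero. *)
Lemma nonvanishing2 f g : f != 0 -> g != 0 -> exists t : 'rV[C]_n,
  [/\ torus t, eval f (monomial t) != 0 & eval g (monomial t) != 0].
Proof.
move=> f0 g0; pose D := (msupp f : seq _) ++ msupp g.
have [a _ a_inj] := weight_separates D [::].
have [p p0 pf] : exists2 p : {poly C}, p != 0 &
    forall s, s != 0 -> p.[s] != 0 -> eval f (monomial (oneparam a s)) != 0.
  by apply: (oneparam_poly a_inj _ f0) => m mf; rewrite mem_cat mf.
have [q q0 qg] : exists2 p : {poly C}, p != 0 &
    forall s, s != 0 -> p.[s] != 0 -> eval g (monomial (oneparam a s)) != 0.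
  by apply: (oneparam_poly a_inj _ g0) => m mf; rewrite mem_cat mf orbT.
have [s] := nat_nonroot (mulf_neq0 (negbT (polyX_eq0 C)) (mulf_neq0 p0 q0)).
rewrite !hornerM hornerX !mulf_eq0 !negb_or => /and3P[s0 ps qs].
exists (oneparam a s%:R); split; [exact: torus_oneparam|exact: pf|exact: qg].
Qed.

Lemma laurent_mulf_neq0 f g : f != 0 -> g != 0 -> f * g != 0.
Proof.
move=> f0 g0; have [t [t0 ft gt]] := nonvanishing2 f0 g0.
apply: contraTneq isT => fg; move: (mulf_neq0 ft gt).
by rewrite -evalM // fg eval0 eqxx.
Qed.

End OneParam.

(** * Prime ideals *)

Section Ideal.
Variable (A : comNzRingType).
Implicit Types (I J S : set A) (u v a : A).

Definition prime_ideal J :=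
  [/\ is_ideal J, ~ J 1 & forall u v, J (u * v) -> J u \/ J v].

Lemma idealMl J a u : is_ideal J -> J u -> J (a * u).
Proof. by move=> [J0 J1] Ju; rewrite -[X in J X]addr0; exact: J1. Qed.

Lemma idealD J u v : is_ideal J -> J u -> J v -> J (u + v).
Proof. by move=> [_ J1] Ju Jv; rewrite -[u]mul1r; exact: J1. Qed.

Lemma idealN J u : is_ideal J -> J u -> J (- u).
Proof. by move=> JI Ju; rewrite -mulN1r; exact: idealMl. Qed.

Lemma idealB J u v : is_ideal J -> J u -> J v -> J (u - v).
Proof. by move=> JI Ju Jv; apply: idealD => //; exact: idealN. Qed.

Lemma ideal_mul_congr J u v a b : is_ideal J ->
  J (u - a) -> J (v - b) -> J (u * v - a * b).
Proof.
move=> JI Ju Jv; have -> : u * v - a * b = u * (v - b) + b * (u - a).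
  by rewrite !mulrBr [b * u]mulrC addrA subrK [b * a]mulrC.
by apply: idealD => //; exact: idealMl.
Qed.

Lemma ideal_inv_congr J u v a b : is_ideal J ->
  u * v = 1 -> a * b = 1 -> J (u - a) -> J (v - b).
Proof.
move=> JI uv ab Ju; have -> : v - b = - (v * b) * (u - a).
  rewrite mulNr mulrBr opprB -!mulrA [b * a]mulrC ab mulr1.
  by rewrite [b * u]mulrC mulrA [v * u]mulrC uv mul1r.
exact: idealMl.
Qed.

Lemma ideal_sum J (T : Type) (r : seq T) (P : pred T) (F : T -> A) :
  is_ideal J -> (forall i, P i -> J (F i)) -> J (\sum_(i <- r | P i) F i).
Proof.
by move=> JI JF; apply: big_ind => //; [exact: JI.1|move=> u v; exact: idealD].
Qed.

Lemma prime_prod J (T : eqType) (r : seq T) (F : T -> A) :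
  prime_ideal J -> J (\prod_(i <- r) F i) -> exists i, J (F i).
Proof.
move=> [_ J1 JP]; elim: r => [|i r IH]; first by rewrite big_nil => /J1.
by rewrite big_cons => /JP[?|/IH //]; exists i.
Qed.

Lemma prime_exp J u e : prime_ideal J -> J (u ^+ e) -> J u.
Proof.
move=> [_ J1 JP]; elim: e => [/J1 //|e IH]; rewrite exprS.
by move=> /JP[].
Qed.

Lemma ideal_adjoin J y : is_ideal J -> is_ideal [set u | exists a, J (u - a * y)].
Proof.
move=> JI; split; first by exists 0; rewrite mul0r subr0; exact: JI.1.
move=> a u v [b Ju] [c Jv]; exists (a * b + c).
have -> : a * u + v - (a * b + c) * y = a * (u - b * y) + (v - c * y).
  by rewrite mulrDl mulrBr opprD !mulrA addrACA.
exact: JI.2.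
Qed.

Lemma maximal_avoiding I S :
  is_ideal I -> S 1 -> (forall u v, S u -> S v -> S (u * v)) ->
  (forall u, I u -> ~ S u) ->
  exists J, [/\ prime_ideal J, I `<=` J, forall u, J u -> ~ S u
    & forall y, ~ J y -> exists s a, S s /\ J (s - a * y)].
Proof.
move=> II S1 SM IS.
pose P J := J = set0 \/ [/\ is_ideal J, I `<=` J & forall u, J u -> ~ S u].
have [F FP Ftot|J [PJ Jmax]] := @Zorn_bigcup A P.
  have [[J0 [FJ0 J0x]]|F0] := pselect (exists J, F J /\ J !=set0); last first.
    left; apply/seteqP; split=> // x [J FJ Jx]; apply: F0.
    by exists J; split=> //; exists x.
  right.
  have idl J x : F J -> J x -> [/\ is_ideal J, I `<=` J & forall u, J u -> ~ S u].
    by move=> /FP[-> //|].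
  split.
  - case: J0x => x /(idl _ _ FJ0) [[J00 _] _ _].
    split=> [|a u v [Ju FJu Juu] [Jv FJv Jvv]]; first by exists J0.
    have [uv|vu] := Ftot _ _ FJu FJv.
      have [[_ JvD] _ _] := idl _ _ FJv Jvv.
      by exists Jv => //; apply: JvD => //; exact: uv.
    have [[_ JuD] _ _] := idl _ _ FJu Juu.
    by exists Ju => //; apply: JuD => //; exact: vu.
  - case: J0x => x /(idl _ _ FJ0) [_ IJ0 _] u Iu; exists J0 => //; exact: IJ0.
  - by move=> u [J FJ Ju]; have [_ _] := idl _ _ FJ Ju; exact.
have {PJ} [JI IJ JS] : [/\ is_ideal J, I `<=` J & forall u, J u -> ~ S u].
  case: PJ => // J0; exfalso; apply: (Jmax I); last by right; split.
  by rewrite J0; split=> // /(_ 0 II.1).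
have Jy y : ~ J y -> exists s a, S s /\ J (s - a * y).
  move=> nJy; pose K : set A := [set u | exists a, J (u - a * y)].
  have KI : is_ideal K by exact: ideal_adjoin.
  have JK : J `<=` K by move=> u Ju; exists 0; rewrite mul0r subr0.
  have Ky : K y by exists 1; rewrite mul1r subrr; exact: JI.1.
  apply: contrapT => H; apply: (Jmax K); first by split=> // /(_ _ Ky).
  right; split=> // [u Iu|u [a Ju] Su]; first by apply: JK; exact: IJ.
  by apply: H; exists u, a.
exists J; split=> //; split=> //; first by move=> J1; exact: (JS 1).
move=> u v Juv; apply: contrapT => /not_orP[/Jy[s [a [Ss Js]]] /Jy[r [b [Sr Jr]]]].
apply: (JS (s * r)); last exact: SM.
(* Modulo [J], [s] is [a * u] and [r] is [b * v], so [s * r] would lie both in [S] and in [J]. *)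
have -> : s * r = s * (r - b * v) + (b * v) * (s - a * u) + (a * b) * (u * v).
  rewrite !mulrBr (mulrC (b * v)) -!mulrA; set x := s * (b * v).
  rewrite addrA subrK -[LHS]addr0 -addrA; congr (_ + _).
  by rewrite addrC [v * (a * u)]mulrCA !mulrA [b * a]mulrC -!mulrA [v * u]mulrC subrr.
by do 2?[apply: idealD => //]; exact: idealMl.
Qed.

End Ideal.

(** * Uncountability of the positive reals *)

Section Uncountable.
Variable (R : realType).

(** The interval from 0 to 1 has Lebesgue measure 1, whereas a countable set has measure 0. *)
Lemma positive_uncountable : ~ countable [set c : R | 0 < c].
Proof.
move=> H.
have : countable [set` (Interval (BRight (0 : R)) (BLeft (1 : R)))].
  apply: (sub_countable _ H); apply: subset_card_le => c /=.
  by rewrite in_itv /= => /andP[].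
move/(@lebesgue_measure.countable_lebesgue_measure0 R).
rewrite lebesgue_measure.lebesgue_measure_itv /=.
rewrite constructive_ereal.lte_fin ltr01 -constructive_ereal.EFinB subr0.
by case=> /eqP; rewrite oner_eq0.
Qed.

Lemma infinite_fiber (g : R -> nat) :
  exists k, infinite_set [set c | 0 < c /\ g c = k].
Proof.
apply: contrapT => /forallNP H; apply: positive_uncountable.
have -> : [set c : R | 0 < c] = \bigcup_(k in setT) [set c | 0 < c /\ g c = k].
  apply/seteqP; split=> [c c0|c [k _ []] //]; by exists (g c).
apply: bigcup_countable => // k _; apply: finite_set_countable.
by apply: contrapT => nfin; exact: (H k nfin).
Qed.

End Uncountable.

(** * Constants, and linear relations between Laurent polynomials *)

Section Scalars.
Variables (R : realType) (n : nat).
Local Notation C := R[i].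
Local Notation L := (laurent C n).

Definition cst (c : C) : L := term c 0.

Fact cst_is_zmod_morphism : zmod_morphism cst.
Proof. by move=> c d; exact: (monalgUB (G := C)). Qed.

Fact cst_is_monoid_morphism : monoid_morphism cst.
Proof. by split=> // c d; rewrite /cst termM addr0. Qed.

HB.instance Definition _ := GRing.isZmodMorphism.Build C L cst cst_is_zmod_morphism.
HB.instance Definition _ := GRing.isMonoidMorphism.Build C L cst cst_is_monoid_morphism.

Lemma eval_cst (c : C) (t : 'rV[C]_n) : eval (cst c) (monomial t) = c.
Proof. by rewrite eval_term monomial0 mulr1. Qed.

Lemma term_cst c m : term c m = cst c * term 1 m.
Proof. by rewrite /cst termM mulr1 add0r. Qed.

Lemma term_neq_cst (m : 'rV[int]_n) c : m != 0 -> term 1 m <> cst c.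
Proof.
move=> m0 /(congr1 (fun f : {malg C['rV[int]_n]} => f@_m)).
rewrite /cst /term mcoeffUU mcoeffU eq_sym (negbTE m0) mulr0n => /eqP.
by rewrite oner_eq0.
Qed.

Lemma coef_cstM (c : C) (f : L) m : (cst c * f)@_m = c * f@_m.
Proof.
have -> : cst c * f = \sum_(a <- msupp f) term (c * f@_a) a.
  rewrite [f in LHS]laurentE mulr_sumr; apply: eq_bigr => a _.
  by rewrite termM add0r.
have -> : (\sum_(a <- msupp f) term (c * f@_a) a)@_m =
          \sum_(a <- msupp f) c * (f@_a *+ (a == m)).
  apply: (etrans (raddf_sum (mcoeff m) _ _ _)); apply: eq_bigr => a _.
  by rewrite mulrnAr; exact: mcoeffU.
rewrite -mulr_sumr; congr (_ * _).
rewrite [in RHS](monalgE (f : {malg C['rV[int]_n]})) raddf_sum.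
by apply: eq_bigr => a _; apply: esym; exact: mcoeffU.
Qed.

(** These are [N.+1] vectors in a space of dimension at most [N], spanned by the monomials whose
    exponents have code below [N]; the matrix of coefficients has a nonzero left kernel. *)
Lemma linear_relation (N : nat) (a : 'I_N.+1 -> L) :
  (forall i (m : 'rV[int]_n), m \in msupp (a i) -> (choice.pickle m < N)%N) ->
  exists lam : 'I_N.+1 -> C, (exists i, lam i != 0) /\
    \sum_i cst (lam i) * a i = 0.
Proof.
move=> aN.
pose M : 'M[C]_(N.+1, N) :=
  \matrix_(i, j) (if choice.unpickle j is Some m then (a i)@_m else 0).
have : kermx M != 0.
  rewrite kermx_eq0; apply/negP => /eqP rM.
  by have := rank_leq_col M; rewrite rM ltnn.
case/rowV0Pn => v /sub_kermxP vM v0; exists (v 0); split.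
  have [i vi|v00] := pickP (fun i => v 0 i != 0); first by exists i.
  by case/eqP: v0; apply/rowP => i; rewrite mxE; apply/eqP/negPn/negbT/v00.
apply/(malgP (G := C)) => m; rewrite mcoeff0.
transitivity (\sum_i v 0 i * (a i)@_m).
  apply: (etrans (raddf_sum (mcoeff m) _ _ _)).
  by apply: eq_bigr => i _; exact: coef_cstM.
have [mN|mN] := ltnP (choice.pickle m) N.
  transitivity ((v *m M) 0 (Ordinal mN)); last by rewrite vM mxE.
  by rewrite !mxE; apply: eq_bigr => i _; rewrite !mxE /= choice.pickleK.
rewrite big1 // => i _; rewrite mcoeff_outdom ?mulr0 //.
by apply: contraL mN => /aN; rewrite ltnNge.
Qed.

(* Otherwise the a c, indexed by the uncountably many c > 0, would be linearly
   independent in a space of countable dimension. *)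
Lemma pencil_relation (y : L) (J : set L) (S : nat -> set L) : is_ideal J ->
  (forall c : R, 0 < c -> exists e s a, S e s /\ J (s - a * (y - cst c%:C%C))) ->
  exists e N (c : 'I_N -> R) (s : 'I_N -> L) (lam : 'I_N -> C),
    [/\ injective c, forall i, 0 < c i, forall i, S e (s i),
        exists i, lam i != 0
      & J (\sum_i cst (lam i) * s i * \prod_(l | l != i) (y - cst (c l)%:C%C))].
Proof.
move=> JI H.
have /choice[F HF] : forall c : R, exists z : nat * L * L,
    0 < c -> S z.1.1 z.1.2 /\ J (z.1.2 - z.2 * (y - cst c%:C%C)).
  move=> c; have [c0|_] := boolP (0 < c); last by exists (0%N, 0, 0).
  by have [e [s [a sa]]] := H c c0; exists (e, s, a).
pose bound c := (\max_(m <- msupp (F c).2) (choice.pickle m).+1)%N.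
(* Infinitely many [c] share both the index [e] and a bound on the codes of the exponents of their
   cofactors, which places these cofactors in one finite-dimensional space. *)
have [k Hk] := infinite_fiber (fun c => choice.pickle ((F c).1.1, bound c)).
have [[e N] eN] : exists eN : nat * nat, choice.pickle eN = k.
  have [B Bk] := infinite_set_fset 1 Hk.
  rewrite cardfs_gt0 => /fset0Pn[c /Bk[_ <-]].
  by exists ((F c).1.1, bound c).
have fiber c : 0 < c /\ choice.pickle ((F c).1.1, bound c) = k ->
    [/\ 0 < c, (F c).1.1 = e & bound c = N].
  by move=> [c0]; rewrite -eN => /(pcan_inj choice.pickleK)[].
have [B Bk NB] := infinite_set_fset N.+1 Hk.
pose c (i : 'I_N.+1) : R := nth 0 B i.
have cB i : c i \in B by rewrite mem_nth // (leq_trans _ NB).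
have cE i : [/\ 0 < c i, (F (c i)).1.1 = e & bound (c i) = N] by apply/fiber/Bk/cB.
have c_inj : injective c.
  move=> i j /eqP; rewrite nth_uniq ?fset_uniq ?(leq_trans _ NB) // => /eqP; exact: val_inj.
pose s i := (F (c i)).1.2; pose a i := (F (c i)).2.
have [lam [lam0 rel]] : exists lam : 'I_N.+1 -> C, (exists i, lam i != 0) /\
    \sum_i cst (lam i) * a i = 0.
  apply: linear_relation => i m mi; have [_ _ <-] := cE i.
  by rewrite /bound (big_rem m) //= leq_max leqnn.
exists e, N.+1, c, s, lam; split=> //.
- by move=> i; have [] := cE i.
- by move=> i; have [c0 <- _] := cE i; have [] := HF _ c0.
set u : L := (X in J X).
(* The subtracted product is zero, and it turns the [i]-th summand into a multiple of
   [s i - a i * (y - c i)], which lies in [J]. *)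
have -> : u = u - (\sum_i cst (lam i) * a i) * \prod_l (y - cst (c l)%:C%C).
  by rewrite rel mul0r subr0.
rewrite /u mulr_suml -sumrB; apply: ideal_sum => // i _.
rewrite [X in _ - _ * X](bigD1 i) //= [X in _ - X]mulrA -mulrBl mulrC; apply: idealMl => //.
rewrite -mulrA -mulrBr; apply: idealMl => //.
by have [c0 _ _] := cE i; have [] := HF _ c0.
Qed.

End Scalars.
Arguments cst {R n} c.

(** * The Nullstellensatz *)

(* Unification would otherwise try to compute products of Laurent polynomials. *)
Local Opaque laurent_mul laurent_one monomial term cst eval.

Section Nullstellensatz.
Variables (R : realType) (n : nat).
Local Notation C := R[i].
Local Notation L := (laurent C n).
Implicit Types (J : set L) (f g y : L) (m : 'rV[int]_n).

Lemma prime_contains_linear J y (q : {poly C}) :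
  prime_ideal J -> q != 0 -> J (map_poly (@cst R n) q).[y] ->
  exists c, J (y - cst c).
Proof.
move=> JP q0; have [r qE] := closed_field_poly_normal q.
rewrite qE map_polyZ rmorph_prod hornerZ horner_prod => H.
have {}H : J (\prod_(z <- r) (y - cst z)).
  have -> : \prod_(z <- r) (y - cst z) =
    cst (lead_coef q)^-1 * (cst (lead_coef q) *
      \prod_(z <- r) (map_poly (@cst R n) ('X - z%:P)).[y]).
    rewrite mulrA -rmorphM mulVf ?lead_coef_eq0 // rmorph1 mul1r.
    by apply: eq_bigr => z _; rewrite map_polyXsubC hornerXsubC.
  by case: JP => JI _ _; exact: idealMl.
exact: prime_prod JP H.
Qed.

(** Being congruent to the value at [t] passes from the coordinates to products and inverses, hence
    to all monomials and to their linear combinations. *)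
Lemma ideal_sub_eval J (t : 'rV[C]_n) g : is_ideal J -> torus t ->
  (forall i, J (term 1 (delta_mx 0 i) - cst (t 0 i))) ->
  J (g - cst (eval g (monomial t))).
Proof.
move=> JI t0 Jt.
pose G m := J (term 1 m - cst (monomial t m)).
have G0 : G 0 by rewrite /G monomial0 subrr; exact: JI.1.
have GD a b : G a -> G b -> G (a + b).
  by rewrite /G term1D (monomialD _ _ t0) rmorphM; exact: ideal_mul_congr.
have GN a : G a -> G (- a).
  apply: (ideal_inv_congr JI); first by rewrite -term1D subrr term10.
  by rewrite -rmorphM mulrC monomialN // rmorph1.
have Gdelta i : G (delta_mx 0 i) by rewrite /G monomial_delta; exact: Jt.
have Gall m : G m by exact: rV_int_ind.
have -> : g - cst (eval g (monomial t)) =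
    \sum_(m <- msupp g) cst g@_m * (term 1 m - cst (monomial t m)).
  rewrite evalE rmorph_sum {1}[g]laurentE -sumrB; apply: eq_bigr => m _.
  by rewrite [RHS]mulrBr; congr (_ - _); [exact: term_cst|exact: rmorphM].
by apply: (ideal_sum _ JI) => m _; apply: (idealMl _ JI); exact: Gall.
Qed.

(** Let [K] above [J] be maximal among the ideals avoiding the powers of [f]. If some [y] were
    congruent to no constant modulo [K], each [y - c] would divide a power of [f] modulo [K], and
    [pencil_relation] would put a nonzero polynomial in [y] into [K]; its linear factors give a
    contradiction. So [K] consists of functions vanishing at a point [t], whose coordinates are the
    constants. *)
Lemma nullstellensatz J f : prime_ideal J -> ~ J f ->
  exists t, zeros J t /\ eval f (monomial t) != 0.
Proof.
move=> JP nJf.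
have [K [KP JK KS Kmax]] : exists K, [/\ prime_ideal K, J `<=` K,
    forall u, K u -> ~ (exists e, u = f ^+ e)
    & forall y, ~ K y -> exists s a, (exists e, s = f ^+ e) /\ K (s - a * y)].
  apply: maximal_avoiding.
  - by case: JP.
  - by exists 0%N.
  - by move=> _ _ [e ->] [e' ->]; exists (e + e')%N; rewrite exprD.
  - by move=> u Ju [e uE]; apply/nJf/(prime_exp (e := e) JP); rewrite -uE.
have [KI K1 Kmul] := KP.
have nKf : ~ K f by move=> Kf; apply: (KS _ Kf); exists 1%N; rewrite expr1.
have coord y : exists c, K (y - cst c).
  apply: contrapT => /forallNP nKy.
  have [e [N [c [s [lam [c_inj c0 sE [i0 lam0] rel]]]]]] :
    exists e N (c : 'I_N -> R) (s : 'I_N -> L) (lam : 'I_N -> C),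
    [/\ injective c, forall i, 0 < c i, forall i, s i = f ^+ e,
        exists i, lam i != 0
      & K (\sum_i cst (lam i) * s i * \prod_(l | l != i) (y - cst (c l)%:C%C))].
    apply: (pencil_relation (S := fun e => [set f ^+ e])) => // c c0.
    have [s [a [[e ->] Ks]]] := Kmax _ (nKy c%:C%C).
    by exists e, (f ^+ e), a.
  (* As every [s i] is [f ^+ e], the relation reads [f ^+ e * q(y)]. At [c i0] only the summand [i0]
     of [q] survives, whence [q != 0]. *)
  pose q : {poly C} := \sum_i lam i *: \prod_(l | l != i) ('X - (c l)%:C%C%:P).
  have q0 : q != 0.
    apply: contraNneq lam0 => /(congr1 (fun p => p.[(c i0)%:C%C])).
    rewrite horner0 horner_sum (bigD1 i0) //= [X in _ + X]big1 ?addr0 => [|i ii0].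
      rewrite hornerZ horner_prod => /eqP; rewrite mulf_eq0 => /orP[//|].
      rewrite prodf_seq_eq0 => /hasP[l _ /andP[li0]].
      rewrite hornerXsubC subr_eq0 => /eqP/complexI/c_inj e0.
      by rewrite e0 eqxx in li0.
    rewrite hornerZ horner_prod (bigD1 i0) 1?eq_sym //= hornerXsubC subrr.
    by rewrite mul0r mulr0.
  have [d Kd] : exists d, K (y - cst d).
    apply: (prime_contains_linear KP q0).
    have : K (f ^+ e * (map_poly (@cst R n) q).[y]).
      rewrite rmorph_sum horner_sum mulr_sumr.
      move: rel; set u := (X in K X -> _); set v := (X in _ -> K X).
      suff -> : v = u by exact.
      apply: eq_bigr => i _.
      rewrite /= map_polyZ hornerZ rmorph_prod horner_prod sE mulrCA mulrA.
      by congr (_ * _); apply: eq_bigr => l _; rewrite /= map_polyXsubC hornerXsubC.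
    by case/Kmul => // /(prime_exp KP).
  exact: nKy Kd.
have /choice[c Kc] : forall i, exists c, K (term 1 (delta_mx 0 i) - cst c).
  by move=> i; exact: coord.
pose t : 'rV[C]_n := \row_i c i.
have t0 : torus t.
  move=> i; rewrite mxE; apply/eqP => ci.
  (* A zero coordinate would put a monomial, which is a unit, into [K]. *)
  apply: K1; have := Kc i; rewrite ci rmorph0 subr0.
  move=> /(idealMl (term 1 (- delta_mx 0 i)) KI).
  by rewrite termM mulr1 addNr.
have Kt g : K (g - cst (eval g (monomial t))).
  by apply: (ideal_sub_eval _ KI t0) => i; rewrite mxE; exact: Kc.
exists t; split; last first.
  by apply/eqP => ft; apply: nKf; have := Kt f; rewrite ft rmorph0 subr0.
split=> // g /JK Kg; apply/eqP/negPn/negP => gt; apply: K1.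
have : K (cst (eval g (monomial t))).
  rewrite -[cst _](subKr g); apply: idealB => //; exact: Kt.
move=> /(idealMl (cst (eval g (monomial t))^-1) KI).
by rewrite -rmorphM mulVf // rmorph1.
Qed.

(** If neither part contains [zeros J], each has an equation outside [J]. Their product is outside
    the prime [J], so it is nonzero at some point of [zeros J], which then lies in neither part. *)
Lemma irreducible_zeros J : prime_ideal J -> irreducible (@torus_closed R n) (zeros J).
Proof.
move=> JP; have [JI J1 JM] := JP; split.
  by have [t [Jt _]] := nullstellensatz JP J1; exists t.
move=> _ _ [E ->] [F ->] JEF; apply: contrapT => /not_orP[nE nF].
have witness G : ~ (zeros J `<=` zeros G) -> exists2 f, G f & ~ J f.
  move=> nG; apply: contrapT => H; apply: nG => t [t0 Jt]; split=> // f Gf.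
  by apply: Jt; apply: contrapT => nJf; apply: H; exists f.
have [f Ef nJf] := witness _ nE; have [g Fg nJg] := witness _ nF.
have [|t [Jt]] := @nullstellensatz J (f * g) JP; first by move=> /JM[].
have [t0 _] := Jt; rewrite evalM // => /eqP; apply.
by case: (JEF t Jt) => -[_ H]; [rewrite (H f Ef) mul0r|rewrite (H g Fg) mulr0].
Qed.

End Nullstellensatz.

(** * Laurent polynomials with exponents in a sublattice *)

Section Chain.
Variables (R : realType) (n : nat) (a : nat -> nat).
Local Notation C := R[i].
Local Notation L := (laurent C n).
Implicit Types (J : set L) (f g : L) (m : 'rV[int]_n) (q : nat).

(** This is the ring C[W_q], consisting of the functions invariant under the first [q] one-parameter
    groups. *)
Definition killed q : set L := [set f | forall m, m \in msupp f ->
  forall l, (l < q)%N -> weight (a l) m = 0].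

Lemma killed_term q c m :
  (forall l, (l < q)%N -> weight (a l) m = 0) -> killed q (term c m).
Proof.
move=> mq m' m'c l lq; suff -> : m' = m by exact: mq.
have := fsubsetP (msuppU_le (x := c) (k := m)) m' m'c.
by rewrite in_fset1 => /eqP.
Qed.

Lemma killed_cst q c : killed q (cst c).
Proof. by apply: killed_term => l _; rewrite weight0. Qed.

Lemma killedD q f g : killed q f -> killed q g -> killed q (f + g).
Proof.
move=> fq gq m /(fsubsetP (msuppD_le _ _)); rewrite in_fsetU.
by move=> /orP[/fq|/gq].
Qed.

Lemma killedM q f g : killed q f -> killed q g -> killed q (f * g).
Proof.
move=> fq gq m /msupp_mul[b [d [bf dg ->]]] l lq.
by rewrite weightD (fq _ bf _ lq) (gq _ dg _ lq) addr0.
Qed.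

Lemma killed_term_sub_cst q m c : (forall l, (l < q)%N -> weight (a l) m = 0) ->
  killed q (term 1 m - cst c).
Proof.
move=> mq; rewrite -rmorphN; apply: killedD; [exact: killed_term|exact: killed_cst].
Qed.

Lemma killed_sum q (I : Type) (r : seq I) (P : pred I) (F : I -> L) :
  (forall i, P i -> killed q (F i)) -> killed q (\sum_(i <- r | P i) F i).
Proof.
move=> FP; apply: (big_ind (killed q)) => //; last exact: killedD.
by rewrite -(rmorph0 (@cst R n)); exact: killed_cst.
Qed.

Lemma killed_prod q (I : Type) (r : seq I) (P : pred I) (F : I -> L) :
  (forall i, P i -> killed q (F i)) -> killed q (\prod_(i <- r | P i) F i).
Proof.
move=> FP; apply: (big_ind (killed q)) => //; last exact: killedM.
by rewrite -(rmorph1 (@cst R n)); exact: killed_cst.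
Qed.

Lemma killedW q f : killed q.+1 f -> killed q f.
Proof. by move=> fq m mf l lq; apply: fq => //; exact: ltnW. Qed.

Lemma exists_int_root (z : int) (c : C) : z != 0 -> c != 0 ->
  exists2 s, s != 0 & s ^ z = c.
Proof.
case: (intP z) => // k _ c0.
  exists (k.+1.-root c); first by rewrite rootC_eq0.
  by rewrite -exprnP rootCK.
exists (k.+1.-root c^-1); first by rewrite rootC_eq0 // invr_eq0.
by rewrite -exprz_inv -exprnP exprVn rootCK // invrK.
Qed.

Lemma eval_killed q f (t : 'rV[C]_n) s : killed q.+1 f -> s != 0 ->
  eval f (monomial (\row_i (t 0 i * oneparam n (a q) s 0 i))) = eval f (monomial t).
Proof.
move=> fq s0; rewrite !evalE big_seq [RHS]big_seq; apply: eq_bigr => m mf.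
by rewrite monomialM monomial_oneparam // (fq m mf q) // expr0z mulr1.
Qed.

Hypothesis a_inj : injective a.

(** If every [c] failed, [pencil_relation] would give a relation lying in [J] and in C[W_q], hence
    an identity. Translating along the group of [a q] moves x^v to any nonzero value without
    changing the [s i]; at the value [c i0] a single nonzero summand remains. *)
Lemma killed_specialize q J v : is_ideal J -> (forall f, J f -> killed q f -> f = 0) ->
  (forall l, (l < q)%N -> weight (a l) v = 0) -> weight (a q) v != 0 ->
  exists c : C, forall f b, J (f - b * (term 1 v - cst c)) -> killed q.+1 f -> f = 0.
Proof.
move=> JI Jq vq v0; apply: contrapT => /forallNP H.
pose S (_ : nat) : set L := [set f | killed q.+1 f /\ f <> 0].
have [e [N [c [s [lam [c_inj c0 sE [i0 lam0] rel]]]]]] :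
    exists e N (c : 'I_N -> R) (s : 'I_N -> L) (lam : 'I_N -> C),
    [/\ injective c, forall i, 0 < c i, forall i, S e (s i),
        exists i, lam i != 0
      & J (\sum_i cst (lam i) * s i * \prod_(l | l != i) (term 1 v - cst (c l)%:C%C))].
  apply: (pencil_relation JI) => c c0.
  have /existsNP[s /existsNP[b /not_implyP[Js /not_implyP[sq s0]]]] := H c%:C%C.
  by exists 0%N, s, b.
have [si0 /eqP sn0] := sE i0.
have [t [t0 st _]] := nonvanishing2 sn0 sn0.
have ci0 : (c i0)%:C%C != 0 :> C by rewrite fmorph_eq0 gt_eqF.
(* The parameter [u] is the one for which the translate [t'] of [t] satisfies x^v = [c i0]. *)
have [u u0 uE] : exists2 u : C, u != 0 & u ^ weight (a q) v = (c i0)%:C%C / monomial t v.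
  by apply: exists_int_root => //; rewrite mulf_neq0 // invr_eq0 monomial_neq0.
pose t' : 'rV[C]_n := \row_i (t 0 i * oneparam n (a q) u 0 i).
have t'0 : torus t' by apply: torusM => //; exact: torus_oneparam.
have yE l : eval (term 1 v - cst (c l)%:C%C) (monomial t') = (c i0)%:C%C - (c l)%:C%C.
  rewrite evalB eval_cst eval_term mul1r monomialM monomial_oneparam // uE.
  rewrite [X in X - _ = _]mulrC mulfVK //; exact: monomial_neq0.
set rel_sum : L := (X in J X) in rel.
have rel0 : rel_sum = 0.
  apply: Jq => //; apply: killed_sum => i _; apply: killedM.
    by apply: killedM; [exact: killed_cst|exact: killedW (sE i).1].
  by apply: killed_prod => l _; exact: killed_term_sub_cst.
have /eqP := congr1 (fun f => eval f (monomial t')) rel0.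
rewrite eval0 eval_sum (bigD1 i0) //= [X in _ + X]big1 ?addr0 => [|i ii0]; last first.
  rewrite (evalM _ _ t'0) (eval_prod _ _ _ t'0) (eq_bigr _ (fun l _ => yE l)).
  have -> : \prod_(l | l != i) ((c i0)%:C%C - (c l)%:C%C) = 0 :> C.
    by rewrite (bigD1 i0) /= 1?eq_sym // subrr mul0r.
  exact: mulr0.
rewrite !(evalM _ _ t'0) eval_cst (eval_prod _ _ _ t'0) (eval_killed _ (sE i0).1 u0).
apply/negP; apply: mulf_neq0; first by rewrite mulf_neq0.
apply/prodf_neq0 => l li0; rewrite yE subr_eq0.
by apply: contraNneq li0 => /complexI/c_inj ->.
Qed.

(** Adjoin x^v - c to [J], with [v] in W_q but not in W_(q+1) and [c] as in [killed_specialize], and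
    take a prime above that avoids the nonzero elements of C[W_(q+1)]. The zero set shrinks
    strictly: x^v - c is a nonzero element of C[W_q], so it is not in [J] and is nonzero somewhere
    on [zeros J]. *)
Lemma prime_step q J : (q < n)%N -> prime_ideal J ->
  (forall f, J f -> killed q f -> f = 0) ->
  exists J', [/\ prime_ideal J', zeros J' `<` zeros J
    & forall f, J' f -> killed q.+1 f -> f = 0].
Proof.
move=> qn JP Jq; have [JI _ _] := JP.
have [v [vq v0]] := weight_dual a_inj qn.
have [c Hc] := killed_specialize JI Jq vq v0.
pose y : L := term 1 v - cst c.
pose I' : set L := [set f | exists b, J (f - b * y)].
have I'I : is_ideal I' by exact: ideal_adjoin.
have [J' [J'P IJ' J'S _]] :
    exists J', [/\ prime_ideal J', I' `<=` J',
      forall f, J' f -> ~ (killed q.+1 f /\ f <> 0)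
      & forall g, ~ J' g -> exists s b, (killed q.+1 s /\ s <> 0) /\ J' (s - b * g)].
  apply: (maximal_avoiding (S := [set f | killed q.+1 f /\ f <> 0]) I'I).
  - split; last by apply/eqP; exact: oner_neq0.
    by rewrite -(rmorph1 (@cst R n)); exact: killed_cst.
  - move=> f g [fq /eqP f0] [gq /eqP g0]; split; first exact: killedM.
    by apply/eqP; exact: laurent_mulf_neq0.
  - by move=> f [b Jf] [fq f0]; apply: f0; apply: Hc fq; exact: Jf.
exists J'; split=> //; last first.
  move=> f J'f fq; apply: contrapT => f0; exact: (J'S f J'f).
have J'y : J' y by apply: IJ'; exists 1; rewrite mul1r subrr; exact: JI.1.
split=> [t [t0 J't]|zJJ'].
  split=> // f Jf; apply: J't; apply: IJ'; exists 0.
  by rewrite mul0r subr0.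
have nJy : ~ J y.
  move=> Jy; have := Jq _ Jy (killed_term_sub_cst vq).
  move=> /eqP; rewrite subr_eq0 => /eqP; apply: term_neq_cst.
  by apply: contraNneq v0 => ->; rewrite weight0.
have [t [Jt /eqP]] := nullstellensatz JP nJy; apply.
by have [_] := zJJ' _ Jt; apply.
Qed.

Lemma prime_chain N q J : (q + N <= n)%N -> prime_ideal J ->
  (forall f, J f -> killed q f -> f = 0) ->
  exists Z : nat -> set 'rV[C]_n,
    [/\ forall j, (j <= N)%N -> irreducible (@torus_closed R n) (Z j) /\ torus_closed (Z j),
      forall j, (j < N)%N -> Z j `<` Z j.+1 & Z N = zeros J].
Proof.
elim: N q J => [|N IH] q J qN JP Jq.
  exists (fun _ => zeros J); split=> // j _; split; first exact: irreducible_zeros.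
  by exists J.
have qN' : (q.+1 + N <= n)%N by rewrite addSnnS.
have [J' [J'P JJ' J'q]] := prime_step (leq_trans (leq_addr N q.+1) qN') JP Jq.
have [Z [Zirr Zlt ZN]] := IH q.+1 J' qN' J'P J'q.
exists (fun j => if (j <= N)%N then Z j else zeros J); split.
- move=> j _; case: ifP => [/Zirr //|_].
  by split; [exact: irreducible_zeros|exists J].
- move=> j; rewrite ltnS => jN; rewrite jN.
  have [jN'|Nj] := ltnP j N; first exact: Zlt.
  by have -> : j = N; [apply/eqP; rewrite eqn_leq jN|rewrite ZN].
- by rewrite ltnn.
Qed.

Lemma exists_killed q (I : set L) d : is_ideal I ->
  has_dim (@torus_closed R n) (zeros I) d -> (d + q < n)%N ->
  exists f, [/\ I f, f != 0 & killed q f].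
Proof.
move=> II [_ dmax] dq; apply: contrapT => noI.
have [J [JP IJ JS _]] :
    exists J, [/\ prime_ideal J, I `<=` J,
      forall f, J f -> ~ (killed q f /\ f <> 0)
      & forall g, ~ J g -> exists s b, (killed q s /\ s <> 0) /\ J (s - b * g)].
  apply: (maximal_avoiding (S := [set f | killed q f /\ f <> 0]) II).
  - split; last by apply/eqP; exact: oner_neq0.
    by rewrite -(rmorph1 (@cst R n)); exact: killed_cst.
  - move=> f g [fq /eqP f0] [gq /eqP g0]; split; first exact: killedM.
    by apply/eqP; exact: laurent_mulf_neq0.
  - by move=> f If [fq /eqP f0]; apply: noI; exists f.
have qn : (q <= n)%N by apply: leq_trans (ltnW dq); exact: leq_addl.
have Jq f : J f -> killed q f -> f = 0.
  by move=> Jf fq; apply: contrapT => f0; exact: (JS f Jf).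
have [Z [Zirr Zlt ZN]] : exists Z : nat -> set 'rV[C]_n,
    [/\ forall j, (j <= n - q)%N -> irreducible (@torus_closed R n) (Z j) /\ torus_closed (Z j),
      forall j, (j < n - q)%N -> Z j `<` Z j.+1 & Z (n - q)%N = zeros J].
  by apply: (@prime_chain _ q) => //; rewrite subnKC.
have Zsub j : (j <= n - q)%N -> Z j `<=` zeros I.
  move=> jn; suff ZJ : Z j `<=` zeros J.
    move=> t /ZJ [t0 Jt]; split=> // f /IJ; exact: Jt.
  rewrite -ZN; move: {-2}(n - q)%N (leqnn (n - q)%N) jn => N.
  elim: N => [|N IH] Nn; first by rewrite leqn0 => /eqP ->.
  rewrite leq_eqVlt => /orP[/eqP -> //|jN].
  by apply: subset_trans (IH (ltnW Nn) jN) _; case: (Zlt _ Nn).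
suff /dmax : irreducible_chain (@torus_closed R n) (zeros I) (n - q).
  by rewrite leqNgt ltn_subRL addnC dq.
exists Z; split=> // j jn; have [Zi Zc] := Zirr j jn; split=> //.
by exists (Z j) => //; apply/esym/setIidr; exact: Zsub.
Qed.

End Chain.

(** * Fans *)

(** [exists_killed] at step [j] involves only the weights of index below [j], so the weight of index
    [j] can be chosen afterwards, to be injective on the exponents of the polynomial just found. *)
Lemma triangular_system (R : realType) (n k d : nat) (I : set (laurent R[i] n)) :
  is_ideal I -> has_dim (@torus_closed R n) (zeros I) d -> (d + k)%N = n ->
  exists (a : nat -> nat) (P : nat -> laurent R[i] n), forall i, (i < k)%N ->
    [/\ I (P i), P i != 0, killed a i (P i)
      & {in msupp (P i) &, injective (weight (a i))}].
Proof.
move=> II dimI dk.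
suff [a [P [_ H]]] : exists (a : nat -> nat) (P : nat -> laurent R[i] n),
    injective a /\ forall i, (i < k)%N -> [/\ I (P i), P i != 0, killed a i (P i)
      & {in msupp (P i) &, injective (weight (a i))}] by exists a, P.
move: {-2}k (leqnn k) => j; elim: j => [|j IH] jk.
  by exists id, (fun _ => 0); split=> //; exact: inj_id.
have [a [P [a_inj aP]]] := IH (ltnW jk).
have [|f [If f0 fj]] := exists_killed a_inj (q := j) II dimI.
  by rewrite -dk ltn_add2l.
have [b bbad b_inj] := weight_separates (msupp f) [seq a l | l <- iota 0 j].
(* Composing with the transposition of [a j] and [b] sets the [j]-th weight to [b], keeps the
   sequence injective, and fixes the earlier weights, [b] being none of them. *)
pose swap x := if x == a j then b else if x == b then a j else x.
have swapK : involutive swap.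
  move=> x; rewrite /swap; have [->|xaj] := eqVneq x (a j).
    by rewrite eqxx; case: eqP.
  have [->|xb] := eqVneq x b; first by rewrite eqxx.
  by rewrite (negbTE xaj) (negbTE xb).
have swapE l : (l < j)%N -> swap (a l) = a l.
  move=> lj; rewrite /swap (inj_eq a_inj) ltn_eqF //.
  suff /negbTE -> : a l != b by [].
  by apply: contraNneq bbad => <-; apply: map_f; rewrite mem_iota.
exists (swap \o a), (fun i => if i == j then f else P i); split.
  by apply: inj_comp => //; exact: inv_inj.
have killedE e (g : laurent R[i] n) : (e <= j)%N -> killed a e g -> killed (swap \o a) e g.
  by move=> ej ge m mg l le; rewrite /= swapE ?ge // (leq_trans le).
move=> i; rewrite ltnS leq_eqVlt => /orP[/eqP ->|ij].
  have swapj : swap (a j) = b by rewrite /swap eqxx.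
  by rewrite eqxx /= swapj; split=> //; exact: killedE.
have [IP P0 Pi Pinj] := aP i ij.
rewrite /= (ltn_eqF ij).
have Qi : killed (swap \o a) i (P i) := killedE i (P i) (ltnW ij) Pi.
by split; rewrite /= ?swapE.
Qed.

(** * Cones of a complete fan and linearity of support functions *)

Section Fan.
Variables (R : realType) (n : nat).
Implicit Types (sigma tau : set 'cV[R]_n) (F : set (set 'cV[R]_n)).

Lemma rational_cone0 sigma : rational_cone sigma -> sigma 0.
Proof.
move=> [r [v ->]]; exists (fun _ => 0); split=> //.
by rewrite big1 // => j _; rewrite scale0r.
Qed.

(** Finitely many intersections produce a cone [tau] of the fan inside all the others. If [xi] is in
    [tau], a cone containing [- xi] also contains [xi], and it is pointed. *)
Lemma zero_cone F : complete_fan F -> F [set 0].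
Proof.
move=> [FF FT].
have common (s : seq (set 'cV[R]_n)) : (forall sigma, sigma \in s -> F sigma) ->
    exists2 tau, F tau & forall sigma, sigma \in s -> tau `<=` sigma.
  elim: s => [_|sigma s IH Fs].
    have : [set: 'cV[R]_n] 0 by [].
    by rewrite -FT => -[sigma Fsigma _]; exists sigma.
  have [|tau Ftau taus] := IH; first by move=> x xs; apply: Fs; rewrite inE xs orbT.
  have Fsigma : F sigma by apply: Fs; rewrite inE eqxx.
  exists (tau `&` sigma).
    by apply: (fan_face FF Ftau); exact: (fan_meet FF Ftau Fsigma).1.
  move=> x; rewrite inE => /orP[/eqP ->|/taus xs]; first exact: subIsetr.
  by apply: subset_trans xs; exact: subIsetl.
have /finite_seqP[s sE] := fan_finite FF.
have [|tau Ftau taus] := common s; first by move=> sigma sigmas; rewrite sE.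
suff <- : tau = [set 0] by [].
apply/seteqP; split=> [xi tauxi|_ ->]; last by apply: rational_cone0; exact: (fan_rational FF).
have : [set: 'cV[R]_n] (- xi) by [].
rewrite -FT => -[sigma Fsigma nxi]; apply: (fan_pointed FF Fsigma) => //.
by apply: taus tauxi; have := Fsigma; rewrite {1}sE.
Qed.

Lemma pairingDr (xi : 'cV[R]_n) x y : pairing xi (x + y) = pairing xi x + pairing xi y.
Proof. by rewrite /pairing mulmxDl mxE. Qed.

Lemma pairingNr (xi : 'cV[R]_n) x : pairing xi (- x) = - pairing xi x.
Proof. by rewrite /pairing mulNmx mxE. Qed.

Lemma pairing_suml (I : Type) (r : seq I) (c : I -> R) (v : I -> 'cV[R]_n) x :
  pairing (\sum_(i <- r) c i *: v i) x = \sum_(i <- r) c i * pairing (v i) x.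
Proof.
rewrite /pairing mulmx_sumr summxE; apply: eq_bigr => i _.
by rewrite -scalemxAr mxE.
Qed.

Definition expt (m : 'rV[int]_n) : 'rV[R]_n := map_mx intr m.

Lemma newton_msupp (P : laurent R[i] n) m : m \in msupp P -> newton P (expt m).
Proof.
move=> mP; exists (fun m' => (m' == m)%:R); split => [m'||]; first exact: ler0n.
  rewrite (big_fsetD1 m) //= eqxx big1_fset ?addr0 // => m'.
  by rewrite in_fsetD1 => /andP[/negPf -> _].
rewrite (big_fsetD1 m) //= eqxx scale1r big1_fset ?addr0 // => m'.
by rewrite in_fsetD1 => /andP[/negPf -> _]; rewrite scale0r.
Qed.

Lemma support_fun_exponent (P : laurent R[i] n) xi : P != 0 ->
  exists2 m, m \in msupp P & support_fun (newton P) xi = pairing xi (expt m).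
Proof.
move=> P0; have [[x [w [w0 w1 ->]] Hx] Hmin] := support_fun_min xi P0.
have [|m mP mmin] := @seq_argmin _ _ (msupp P) (fun m => pairing xi (expt m)).
  apply: contraNneq P0 => P0; apply/eqP; rewrite (laurentE P) P0; exact: big_nil.
exists m => //; apply/eqP; rewrite eq_le Hmin /=; last exact: newton_msupp.
rewrite -Hx pairing_sum -[leLHS]mul1r -[X in X * pairing xi (expt m)]w1 mulr_suml.
rewrite big_seq [leRHS]big_seq.
apply: ler_sum => m' m'P. by apply: ler_wpM2l; [exact: w0|exact: mmin].
Qed.

(** Take an exponent [u] attaining the minimum at the sum of the generators. On each generator the
    pairing with [u] exceeds the linear support function by a nonnegative amount; these amounts sum
    to zero, so both agree on [sigma]. *)
Lemma linear_support_vertex (P : laurent R[i] n) sigma : P != 0 ->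
  rational_cone sigma -> linear_on sigma (support_fun (newton P)) ->
  exists2 u, u \in msupp P &
    forall xi, sigma xi -> support_fun (newton P) xi = pairing xi (expt u).
Proof.
move=> P0 [r [v sE]] [x Hx].
pose xi0 : 'cV[R]_n := \sum_j 1 *: map_mx intr (v j).
have sv j : sigma (map_mx intr (v j)).
  rewrite sE; exists (fun l => (l == j)%:R); split=> [l|]; first exact: ler0n.
  rewrite (bigD1 j) //= eqxx scale1r big1 ?addr0 // => l /negbTE ->.
  by rewrite scale0r.
have sxi0 : sigma xi0 by rewrite sE; exists (fun _ => 1).
have [u uP Hu] := support_fun_exponent xi0 P0; exists u => //.
pose g xi := pairing xi (expt u) - pairing xi x.
have gv j : g (map_mx intr (v j)) = 0.
  have : \sum_j g (map_mx intr (v j)) == 0.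
    rewrite /g sumrB subr_eq0.
    have := Hu; rewrite Hx // !pairing_suml => /esym /eqP.
    by under eq_bigr do rewrite mul1r; under [X in _ == X]eq_bigr do rewrite mul1r.
  rewrite psumr_eq0 => [/allP /(_ j (mem_index_enum _)) /eqP //|l _].
  rewrite /g subr_ge0 -Hx //; have [_] := support_fun_min (map_mx intr (v l)) P0.
  by apply; exact: newton_msupp.
move=> xi sxi; rewrite Hx //; apply/eqP; rewrite eq_sym -subr_eq0.
move: sxi; rewrite sE => -[c [_ ->]]; rewrite !pairing_suml -sumrB.
by rewrite big1 // => j _; rewrite -mulrBr [_ - _]gv mulr0.
Qed.

End Fan.
Arguments expt {R n} m.

(** * Divisors on a toric variety *)

Section Toric.
Variables (R : realType) (n : nat).
Local Notation C := R[i].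
Local Notation L := (laurent C n).
Implicit Types (sigma tau : set 'cV[R]_n) (F : set (set 'cV[R]_n)).
Implicit Types (x y : 'rV[int]_n -> C) (t s : 'rV[C]_n) (m u : 'rV[int]_n) (P Q : L).

Lemma dual_semigroupS sigma tau m :
  sigma `<=` tau -> dual_semigroup tau m -> dual_semigroup sigma m.
Proof. by move=> st mtau xi /st; exact: mtau. Qed.

Lemma toric_pt_self F sigma x : F sigma -> chart sigma x -> toric_pt F sigma x (sigma, x).
Proof.
by move=> Fs cx; split=> //; exists x => //=; rewrite setIid.
Qed.

Lemma toric_pt_glued F sigma x tau x' : F tau -> chart tau x' ->
  toric_pt F sigma x = toric_pt F tau x' -> glued (sigma, x) (tau, x').
Proof.
by move=> Ft cx' e; have := toric_pt_self Ft cx'; rewrite -e => -[].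
Qed.

(** In each chart an intersection of closed sets is cut out by all regular functions that vanish on
    the trace of one of them. The whole variety is one of these closed sets, which keeps the
    intersection inside it. *)
Lemma toric_closed_closure F (Y : set (set (set 'cV[R]_n * ('rV[int]_n -> C)))) :
  Y `<=` toric_variety F -> toric_closed F (smallest (toric_closed F) Y).
Proof.
move=> YF.
have varF : toric_closed F (toric_variety F).
  split=> // sigma Fs; exists set0 => //; apply/seteqP; split=> x [cx _] //=.
  by split=> //; exists sigma, x.
split=> [p|sigma Fs]; first by apply.
pose E : set L := [set f | (forall m, m \in msupp f -> dual_semigroup sigma m) /\
  exists A, [/\ toric_closed F A, Y `<=` A &
    forall x, chart sigma x -> A (toric_pt F sigma x) -> eval f x = 0]].
exists E; first by move=> f m [+ _]; exact.
apply/seteqP; split=> x [cx H]; split=> //.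
  by move=> f [_ [A [Ac YA]]]; apply=> //; exact: H.
move=> A [Ac YA]; have [E' E's AE] := Ac.2 _ Fs.
suff : [set x | chart sigma x /\ A (toric_pt F sigma x)] x by case.
rewrite AE; split=> // f E'f; apply: H; split; first by move=> m; exact: E's.
exists A; split=> // x' cx' Ax'.
have : [set x | chart sigma x /\ A (toric_pt F sigma x)] x' by [].
by rewrite AE => -[_]; apply.
Qed.

Section Divisor.
Variables (F : set (set 'cV[R]_n)) (u : set 'cV[R]_n -> 'rV[int]_n) (Q : L).
Hypothesis Q_regular : forall sigma m, F sigma -> m \in msupp Q ->
  dual_semigroup sigma (m - u sigma).
Hypothesis u_compat : forall sigma tau xi, F sigma -> F tau -> sigma xi -> tau xi ->
  pairing xi (expt (u sigma)) = pairing xi (expt (u tau)).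

(** The regular function Q / x^(u sigma): [Q] is seen as a section of the line bundle trivialized
    over the chart of [sigma] by x^(u sigma). *)
Definition local_eq sigma x : C := eval Q (fun m => x (m - u sigma)).

Definition divisor : set (set (set 'cV[R]_n * ('rV[int]_n -> C))) :=
  [set p | exists sigma x, [/\ F sigma, chart sigma x, p = toric_pt F sigma x
    & local_eq sigma x = 0]].

(** Over the common chart the two local equations differ by the factor [y (u sigma - u tau)], which
    is regular there because [u sigma] and [u tau] agree on the common cone. *)
Lemma local_eq_glued sigma tau x x' : F sigma -> F tau ->
  glued (sigma, x) (tau, x') -> local_eq sigma x = 0 -> local_eq tau x' = 0.
Proof.
move=> Fs Ft [y [_ yM _] /= [yx yx']] sx.
have sI : sigma `&` tau `<=` sigma by exact: subIsetl.
have tI : sigma `&` tau `<=` tau by exact: subIsetr.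
suff -> : local_eq tau x' = local_eq sigma x * y (u sigma - u tau) by rewrite sx mul0r.
rewrite /local_eq !evalE mulr_suml big_seq [RHS]big_seq; apply: eq_bigr => m mQ.
have ms := Q_regular Fs mQ; have mt := Q_regular Ft mQ.
rewrite -(yx _ ms) -(yx' _ mt) -mulrA -yM; last 2 first.
- exact: dual_semigroupS sI ms.
- move=> xi [sxi txi]; rewrite /dual_semigroup map_mxB pairingDr pairingNr.
  by rewrite subr_ge0 -!/(expt _) (u_compat Fs Ft sxi txi).
- by rewrite addrA subrK.
Qed.

Lemma divisorP sigma x : F sigma -> chart sigma x ->
  divisor (toric_pt F sigma x) <-> local_eq sigma x = 0.
Proof.
move=> Fs cx; split=> [[tau [x' [Ft cx' e sx']]]|sx]; last by exists sigma, x.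
by apply: (local_eq_glued Ft Fs _ sx'); exact: (toric_pt_glued Fs cx (esym e)).
Qed.

Lemma divisor_closed : toric_closed F divisor.
Proof.
split=> [p [sigma [x [Fs cx -> _]]]|sigma Fs]; first by exists sigma, x.
pose q : L := \sum_(m <- msupp Q) term Q@_m (m - u sigma).
have qE x : eval q x = local_eq sigma x.
  by rewrite eval_sum /local_eq evalE; apply: eq_bigr => m _; rewrite eval_term.
exists [set q].
  move=> _ m -> mq; have [m' m'Q ->] : exists2 m', m' \in msupp Q & m = m' - u sigma.
    apply: contrapT => H; move: mq; rewrite -mcoeff_neq0 => /eqP; apply.
    apply: (etrans (raddf_sum (mcoeff m) _ _ _)); rewrite big_seq big1 // => m' m'Q.
    apply: (etrans (mcoeffU _ _ _)); case: eqP => [e|_]; last by rewrite mulr0n.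
    by case: H; exists m'.
  exact: Q_regular.
apply/seteqP; split=> x [cx H]; split=> //.
  by move=> _ ->; rewrite qE; exact/divisorP.
by apply/divisorP => //; rewrite -qE; exact: H.
Qed.

End Divisor.

End Toric.

(** * Dimension of orbits *)

Section Orbit.
Variables (R : realType) (n : nat).
Local Notation C := R[i].
Local Notation L := (laurent C n).
Implicit Types (sigma tau : set 'cV[R]_n) (F : set (set 'cV[R]_n)).
Implicit Types (x y : 'rV[int]_n -> C) (t s : 'rV[C]_n) (m : 'rV[int]_n) (P Q : L).

Definition twist t x : 'rV[int]_n -> C := fun m => monomial t m * x m.

Lemma chart_twist sigma t x : torus t -> chart sigma x -> chart sigma (twist t x).
Proof.
move=> t0 [x0 xM xN]; split=> [|b c bs cs|m ms]; rewrite /twist.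
- by rewrite monomial0 x0 mulr1.
- by rewrite monomialD // xM // mulrACA.
- by rewrite xN // mulr0.
Qed.

Lemma glued_twist sigma x tau x' t : torus t ->
  glued (sigma, x) (tau, x') -> glued (sigma, twist t x) (tau, twist t x').
Proof.
move=> t0 [y cy [yx yx']]; exists (twist t y); first exact: chart_twist.
by split=> m ms; rewrite /twist /=; [rewrite (yx m ms)|rewrite (yx' m ms)].
Qed.

Lemma torus_act_pt F sigma x t : torus t ->
  torus_act t (toric_pt F sigma x) = toric_pt F sigma (twist t x).
Proof.
move=> t0; apply/seteqP; split=> [_ [[tau x'] [Ft cx' gx] <-]|[tau x'] [Ft cx' gx]].
  by split=> //=; [exact: chart_twist|exact: glued_twist].
pose v : 'rV[C]_n := \row_i (t 0 i)^-1.
have v0 : torus v by move=> i; rewrite mxE invr_eq0.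
have vK z : twist v (twist t z) = z.
  by apply/funext => m; rewrite /twist mulrA monomialVM // mul1r.
have tK z : twist t (twist v z) = z.
  by apply/funext => m; rewrite /twist mulrA [X in X * _]mulrC monomialVM // mul1r.
exists (tau, twist v x') => /=; last by rewrite -[in RHS](tK x').
split=> //=; first exact: chart_twist.
by rewrite -[x]vK; exact: glued_twist.
Qed.

Lemma orbit_twist F sigma x t : torus t ->
  Defs.orbit (toric_pt F sigma (twist t x)) `<=` Defs.orbit (toric_pt F sigma x).
Proof.
move=> t0 _ [s s0 <-]; exists (\row_i (s 0 i * t 0 i)); first exact: torusM.
rewrite !torus_act_pt //; last exact: torusM.
by congr toric_pt; apply/funext => m; rewrite /twist monomialM mulrA.
Qed.

Section Chain.
Variables (a : nat -> nat) (F : set (set 'cV[R]_n)) (sigma : set 'cV[R]_n).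
Variable (x : 'rV[int]_n -> C).
Hypotheses (Fs : F sigma) (cx : chart sigma x).

(** For every [j] the parameter [s] ranges over the same [n]-dimensional torus, so that equations
    pull back to Laurent polynomials in [n] variables; coordinates of index at least [j] are
    ignored. *)
Definition subtorus_pt (j : nat) s : 'rV[C]_n :=
  \row_i \prod_(l < n | (l < j)%N) oneparam n (a l) (s 0 l) 0 i.

Definition subtorus_exp (j : nat) m : 'rV[int]_n :=
  \row_(l < n) (if (l < j)%N then weight (a l) m else 0).

Lemma torus_subtorus_pt j s : torus s -> torus (subtorus_pt j s).
Proof.
by move=> s0 i; rewrite mxE; apply/prodf_neq0 => l _; exact: torus_oneparam.
Qed.

Lemma monomial_subtorus_pt j s m : torus s ->
  monomial (subtorus_pt j s) m = monomial s (subtorus_exp j m).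
Proof.
move=> s0; rewrite monomial_prod big_mkcond monomialE; apply: eq_bigr => l _.
by rewrite mxE; case: ifP => _; [exact: monomial_oneparam|rewrite expr0z].
Qed.

Definition suborbit j : set (set (set 'cV[R]_n * ('rV[int]_n -> C))) :=
  [set toric_pt F sigma (twist (subtorus_pt j s) x) | s in @torus R n].

Lemma suborbit_orbit j : suborbit j `<=` Defs.orbit (toric_pt F sigma x).
Proof.
move=> _ [s s0 <-]; exists (subtorus_pt j s); first exact: torus_subtorus_pt.
by rewrite torus_act_pt //; exact: torus_subtorus_pt.
Qed.

Lemma suborbit_toric j : suborbit j `<=` toric_variety F.
Proof.
move=> _ [s s0 <-]; exists sigma, (twist (subtorus_pt j s) x); split=> //.
by apply: chart_twist => //; exact: torus_subtorus_pt.
Qed.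

Lemma suborbitS j : suborbit j `<=` suborbit j.+1.
Proof.
move=> _ [s s0 <-]; pose s' : 'rV[C]_n := \row_l if (l < j)%N then s 0 l else 1.
have <- : subtorus_pt j.+1 s' = subtorus_pt j s.
  apply/rowP => i; rewrite !mxE.
  rewrite big_mkcond [RHS]big_mkcond; apply: eq_bigr => l _; rewrite !mxE.
  rewrite ltnS leq_eqVlt; case: ltnP => [lj|_]; first by rewrite orbT.
  by rewrite orbF; case: ifP => // _; rewrite exp1rz.
apply: imageP => l; rewrite mxE; case: ifP => _; [exact: s0|exact: oner_neq0].
Qed.

(** Some local equation of [A] is nonzero at a point of the suborbit; [h] is its pullback to the
    parameter torus. *)
Lemma suborbit_equation j A : toric_closed F A -> ~ (suborbit j `<=` A) ->
  exists2 h : L, h != 0 & forall s, torus s ->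
    A (toric_pt F sigma (twist (subtorus_pt j s) x)) -> eval h (monomial s) = 0.
Proof.
move=> Ac nYA; have [E _ AE] := Ac.2 _ Fs.
have ct s : torus s -> chart sigma (twist (subtorus_pt j s) x).
  by move=> s0; apply: chart_twist => //; exact: torus_subtorus_pt.
have [s0 [ts0 [f Ef fs0]]] : exists s0, torus s0 /\
    exists2 f, E f & eval f (twist (subtorus_pt j s0) x) <> 0.
  apply: contrapT => H; apply: nYA => _ [s ts <-].
  suff : [set x | chart sigma x /\ A (toric_pt F sigma x)] (twist (subtorus_pt j s) x).
    by case.
  rewrite AE; split=> [|f Ef]; first exact: ct.
  by apply: contrapT => fs; apply: H; exists s; split=> //; exists f.
pose h : L := \sum_(m <- msupp f) term (f@_m * x m) (subtorus_exp j m).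
have hE s : torus s -> eval h (monomial s) = eval f (twist (subtorus_pt j s) x).
  move=> ts; rewrite eval_sum evalE; apply: eq_bigr => m _.
  by rewrite eval_term /twist monomial_subtorus_pt // mulrA [RHS]mulrAC.
exists h.
  by apply/eqP => h0; apply: fs0; rewrite -hE // h0 eval0.
move=> s ts As; rewrite hE //.
have : [set x | chart sigma x /\ A (toric_pt F sigma x)] (twist (subtorus_pt j s) x).
  by split=> //; exact: ct.
by rewrite AE => -[_]; apply.
Qed.

Lemma suborbit_irreducible j A B : toric_closed F A -> toric_closed F B ->
  suborbit j `<=` A `|` B -> suborbit j `<=` A \/ suborbit j `<=` B.
Proof.
move=> Ac Bc YAB; apply: contrapT => /not_orP[nA nB].
have [f f0 fA] := suborbit_equation Ac nA; have [g g0 gB] := suborbit_equation Bc nB.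
have [s [ts /eqP fs /eqP gs]] := nonvanishing2 f0 g0.
by have [/(fA _ ts)|/(gB _ ts)] := YAB _ (imageP _ ts).
Qed.

(** The chain consists of the traces on [S] of the closures of the suborbits. The closed set [A]
    attached to [j] contains the [j]-th suborbit, on which the monomial of [e j] is 1, but not the
    next one, where this monomial varies. *)
Lemma orbit_chain (k : nat) (e : nat -> 'rV[int]_n) (S : set _) : (k <= n)%N ->
  Defs.orbit (toric_pt F sigma x) `<=` S ->
  (forall j, (j < k)%N -> [/\ forall l, (l < j)%N -> weight (a l) (e j) = 0,
     weight (a j) (e j) != 0
   & exists2 A, toric_closed F A & forall t, torus t ->
       A (toric_pt F sigma (twist t x)) <-> monomial t (e j) = 1]) ->
  irreducible_chain (toric_closed F) S k.
Proof.
move=> kn OS H; pose cl j := smallest (toric_closed F) (suborbit j).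
have clc j : toric_closed F (cl j) by apply: toric_closed_closure; exact: suborbit_toric.
have subcl j : suborbit j `<=` cl j by exact: sub_gen_smallest.
have subS j : suborbit j `<=` S by apply: subset_trans OS; exact: suborbit_orbit.
have one : torus (const_mx 1 : 'rV[C]_n) by move=> i; rewrite mxE oner_neq0.
exists (fun j => S `&` cl j); split=> j jk.
  split; last by exists (cl j).
  split.
    exists (toric_pt F sigma (twist (subtorus_pt j (const_mx 1)) x)).
    by split; [apply: (subS j)|apply: subcl]; exact: imageP.
  move=> A B Ac Bc SAB.
  have [|YA|YB] := @suborbit_irreducible j A B Ac Bc.
  - by move=> p Yp; apply: SAB; split; [exact: subS Yp|exact: subcl].
  - by left=> p [_]; apply: smallest_sub YA p.
  - by right=> p [_]; apply: smallest_sub YB p.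
have clS : cl j `<=` cl j.+1.
  apply: (smallest_sub (clc j.+1)); exact: subset_trans (@suborbitS j) (subcl _).
split; first exact: setIS.
have [ej0 ejj [A Ac AE]] := H _ jk.
have clA : cl j `<=` A.
  apply: smallest_sub => // _ [s ts <-]; apply/AE; first exact: torus_subtorus_pt.
  rewrite monomial_subtorus_pt // (_ : subtorus_exp j (e j) = 0) ?monomial0 //.
  by apply/rowP => l; rewrite !mxE; case: ifP => // /ej0.
(* Any nonzero value other than 1 would do: [q] is a point of the next suborbit where the monomial
   of [e j] equals 2. *)
have two_neq0 : 2 != 0 :> C by rewrite pnatr_eq0.
have [v v0 vE] := exists_int_root ejj two_neq0.
have tv : torus (const_mx v : 'rV[C]_n) by move=> i; rewrite mxE.
pose q := toric_pt F sigma (twist (subtorus_pt j.+1 (const_mx v)) x).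
have Yq : suborbit j.+1 q by exact: imageP.
move=> /(_ q (conj (subS _ _ Yq) (subcl _ _ Yq)))[_ /clA].
move/(AE _ (torus_subtorus_pt _ tv)); rewrite monomial_subtorus_pt // monomialE.
have jn : (j < n)%N by exact: leq_trans kn.
rewrite (bigD1 (Ordinal jn)) //= big1 => [|l /negP lj].
  by rewrite !mxE /= ltnSn vE mulr1 => /eqP; rewrite -[1]/(1%:R) eqr_nat.
rewrite !mxE; case: ifP => [|_]; last by rewrite expr0z.
rewrite ltnS leq_eqVlt => /orP[/eqP lE|/ej0 ->]; last by rewrite expr0z.
by case: lj; apply/eqP/val_inj.
Qed.

End Chain.
End Orbit.

(** * From convenient to good compactifications *)

Section Good.
Variables (R : realType) (n : nat).
Local Notation C := R[i].
Local Notation L := (laurent C n).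
Implicit Types (sigma tau : set 'cV[R]_n) (F : set (set 'cV[R]_n)) (P : L).

Lemma convenient_vertices F P : P != 0 -> is_fan F ->
  (forall sigma, F sigma -> linear_on sigma (support_fun (newton P))) ->
  exists u : set 'cV[R]_n -> 'rV[int]_n,
    [/\ forall sigma, F sigma -> u sigma \in msupp P,
      forall sigma m, F sigma -> m \in msupp P -> dual_semigroup sigma (m - u sigma)
    & forall sigma tau xi, F sigma -> F tau -> sigma xi -> tau xi ->
        pairing xi (expt (u sigma)) = pairing xi (expt (u tau))].
Proof.
move=> P0 FF Plin.
have /choice[u Hu] : forall sigma, exists u, F sigma -> u \in msupp P /\
    forall xi, sigma xi -> support_fun (newton P) xi = pairing xi (expt u).
  move=> sigma; have [Fs|nFs] := pselect (F sigma); last by exists 0.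
  have [u uP uE] := linear_support_vertex P0 (fan_rational FF Fs) (Plin _ Fs).
  by exists u.
exists u; split.
- by move=> sigma /Hu[].
- move=> sigma m /Hu[_ uE] mP xi sxi.
  rewrite map_mxB pairingDr pairingNr subr_ge0 -[X in X <= _]uE //.
  by have [_] := support_fun_min xi P0; apply; exact: newton_msupp.
- by move=> sigma tau xi /Hu[_ su] /Hu[_ tu] sxi txi; rewrite -su // tu.
Qed.

(** The divisor of [P] is closed and contains the image of [X], so P / x^(u sigma) vanishes at [x].
    Its term at [u sigma] is a nonzero constant, so another term must be nonzero too. *)
Lemma closure_exponent F P (u : set 'cV[R]_n -> 'rV[int]_n) (X : set 'rV[C]_n) sigma x :
  complete_fan F ->
  (forall tau, F tau -> u tau \in msupp P) ->
  (forall tau m, F tau -> m \in msupp P -> dual_semigroup tau (m - u tau)) ->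
  (forall tau tau' xi, F tau -> F tau' -> tau xi -> tau' xi ->
    pairing xi (expt (u tau)) = pairing xi (expt (u tau'))) ->
  X `<=` @torus R n -> (forall t, X t -> eval P (monomial t) = 0) ->
  F sigma -> chart sigma x -> toric_closure F X (toric_pt F sigma x) ->
  exists m, [/\ m \in msupp P, m != u sigma & x (m - u sigma) != 0].
Proof.
move=> FC uP ureg ucomp Xt XP Fs cx clx; have F0 := zero_cone FC.
have : divisor F u P (toric_pt F sigma x).
  apply: clx; split; first exact: divisor_closed.
  move=> _ [t Xtt <-]; have t0 := Xt _ Xtt.
  (* A torus point is examined in the chart of the zero cone, where every monomial is regular. *)
  exists [set 0], (monomial t); split=> //.
    split=> [|b c _ _|m []]; [exact: monomial0|exact: monomialD|].
    by move=> _ ->; rewrite /pairing mulmx0 mxE.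
  rewrite /local_eq -(mul0r (monomial t (- u [set 0]))) -(XP _ Xtt) !evalE mulr_suml.
  by apply: eq_bigr => m _; rewrite monomialD // mulrA.
move/(divisorP ureg ucomp Fs cx); rewrite /local_eq evalE => Px.
apply: contrapT => H; have := uP _ Fs; rewrite -mcoeff_neq0 => /eqP; apply.
move: Px; rewrite (big_fsetD1 (u sigma)) ?uP //= subrr big_seq big1 ?addr0 => [|m].
  by case: cx => -> _ _; rewrite mulr1.
rewrite in_fsetD1 => /andP[mu mP].
have -> : x (m - u sigma) = 0; last by rewrite mulr0.
by apply/eqP/negPn/negP => xm; apply: H; exists m.
Qed.

(* The witness is the divisor of the section x^m - c x^u, c being x (m - u). *)
Lemma binomial_divisor F P (u : set 'cV[R]_n -> 'rV[int]_n) sigma x m :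
  (forall tau, F tau -> u tau \in msupp P) ->
  (forall tau m, F tau -> m \in msupp P -> dual_semigroup tau (m - u tau)) ->
  (forall tau tau' xi, F tau -> F tau' -> tau xi -> tau' xi ->
    pairing xi (expt (u tau)) = pairing xi (expt (u tau'))) ->
  m \in msupp P -> F sigma -> chart sigma x -> x (m - u sigma) != 0 ->
  exists2 A, toric_closed F A & forall t, torus t ->
    A (toric_pt F sigma (twist t x)) <-> monomial t (m - u sigma) = 1.
Proof.
move=> uP ureg ucomp mP Fs cx xm.
pose Q : L := term 1 m - term (x (m - u sigma)) (u sigma).
have Qreg tau m' : F tau -> m' \in msupp Q -> dual_semigroup tau (m' - u tau).
  move=> Ft m'Q; apply: ureg => //.
  have := fsubsetP (msuppB_le _ _) _ m'Q; rewrite in_fsetU => /orP[] H.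
    have := fsubsetP (msuppU_le (x := 1 : C) (k := m)) m' H.
    by rewrite in_fset1 => /eqP ->.
  have := fsubsetP (msuppU_le (x := x (m - u sigma)) (k := u sigma)) m' H.
  by rewrite in_fset1 => /eqP ->; exact: uP.
exists (divisor F u Q); first exact: divisor_closed.
move=> t t0; rewrite (divisorP Qreg ucomp Fs (chart_twist t0 cx)).
rewrite /local_eq evalB !eval_term subrr mul1r /twist monomial0 mul1r.
case: (cx) => -> _ _; rewrite mulr1.
split=> [/eqP|->]; last by rewrite mul1r subrr.
by rewrite subr_eq0 -[X in _ == X]mul1r => /eqP/(mulIf xm).
Qed.

(** A common point of the closure of [X] and an orbit yields, through [orbit_chain], a chain of
    length [k] in that orbit, so the dimension of the orbit is at least [k]. *)
Lemma triangular_good F (X : set 'rV[C]_n) (k : nat) (a : nat -> nat) (P : 'I_k -> L) :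
  (k <= n)%N -> X `<=` @torus R n -> (forall i t, X t -> eval (P i) (monomial t) = 0) ->
  (forall i, P i != 0) -> (forall i : 'I_k, killed a i (P i)) ->
  (forall i : 'I_k, {in msupp (P i) &, injective (weight (a i))}) ->
  complete_fan F -> convenient F P -> good_compactification F X k.
Proof.
move=> kn Xt XP P0 Pk Pinj FC Pconv p d [sigma [x0 [Fs cx0 ->]]] [_ dmax] dk.
apply/seteqP; split=> // q [clq [t t0 qE]]; move: clq; rewrite -qE torus_act_pt //.
have cx : chart sigma (twist t x0) by exact: chart_twist.
have OS := @orbit_twist _ _ F sigma x0 t t0.
move: (twist t x0) cx OS => x cx OS clx.
suff /dmax : irreducible_chain (toric_closed F) (Defs.orbit (toric_pt F sigma x0)) k.
  by rewrite leqNgt dk.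
have /choice[e He] : forall j, exists e : 'rV[int]_n, (j < k)%N ->
    [/\ forall l, (l < j)%N -> weight (a l) e = 0, weight (a j) e != 0
   & exists2 A, toric_closed F A & forall t, torus t ->
       A (toric_pt F sigma (twist t x)) <-> monomial t e = 1].
  move=> j; have [jk|kj] := ltnP j k; last by exists 0.
  pose i := Ordinal jk.
  have [u [uP ureg ucomp]] := convenient_vertices (P0 i) FC.1 (Pconv i).
  have [m [mP mu xm]] := closure_exponent FC uP ureg ucomp Xt (XP i) Fs cx clx.
  exists (m - u sigma) => _; split.
  (* Both [m] and [u sigma] are exponents of [P i]: the earlier weights vanish on them, and the
     weight of index [j] tells them apart. *)
  - move=> l lj; rewrite weightB (Pk i m mP l lj) (Pk i _ (uP _ Fs) l lj).
    by rewrite subrr.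
  - rewrite weightB subr_eq0; apply: contraNneq mu => w.
    by apply/eqP; apply: (Pinj i) => //; exact: uP.
  - exact: (binomial_divisor uP ureg ucomp mP Fs cx xm).
exact: (orbit_chain Fs cx kn OS He).
Qed.

End Good.

Theorem corollary17 (R : realType) (n k : nat) (X : set 'rV[R[i]]_n) :
  torus_closed X -> has_codim X k ->
  (exists P : 'I_k -> laurent R[i] n,
     [/\ forall i, P i != 0,
         forall i t, X t -> eval (P i) (monomial t) = 0
       & forall F : set (set 'cV[R]_n), complete_fan F -> convenient F P ->
           good_compactification F X k]) /\
  (forall I : set (laurent R[i] n), is_ideal I -> zeros I = X ->
     exists P : 'I_k -> laurent R[i] n,
     [/\ forall i, I (P i),
         forall i, P i != 0,
         forall i t, X t -> eval (P i) (monomial t) = 0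
       & forall F : set (set 'cV[R]_n), complete_fan F -> convenient F P ->
           good_compactification F X k]).
Proof.
move=> [E XE] [d dimX dk].
have ideal_case (I : set (laurent R[i] n)) : is_ideal I -> zeros I = X ->
     exists P : 'I_k -> laurent R[i] n,
     [/\ forall i, I (P i), forall i, P i != 0,
         forall i t, X t -> eval (P i) (monomial t) = 0
       & forall F : set (set 'cV[R]_n), complete_fan F -> convenient F P ->
           good_compactification F X k].
  move=> II IX; rewrite -IX in dimX.
  have [a [P aP]] := triangular_system II dimX dk.
  have XP (i : 'I_k) t : X t -> eval (P i) (monomial t) = 0.
    by rewrite -IX => -[_]; apply; have [] := aP i (ltn_ord i).
  exists (fun i => P i); split=> // [i|i|F FC Pconv]; try by have [] := aP i (ltn_ord i).
  apply: (@triangular_good _ _ F X k a (fun i => P i)) => //.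
  - by rewrite -dk leq_addl.
  - by rewrite -IX => t [].
  - by move=> i; have [] := aP i (ltn_ord i).
  - by move=> i; have [] := aP i (ltn_ord i).
  - by move=> i; have [] := aP i (ltn_ord i).
split=> //.
(* The first claim is the second one for the ideal of all functions vanishing on [X], whose zero set
   is [X] because [X] is closed. *)
pose IX : set (laurent R[i] n) := [set f | forall t, X t -> eval f (monomial t) = 0].
have Xt : X `<=` @torus R n by rewrite XE => t [].
have IXI : is_ideal IX.
  split=> [t _|f g h IXg IXh t Xtt]; first exact: eval0.
  by rewrite evalD (evalM _ _ (Xt _ Xtt)) (IXg _ Xtt) (IXh _ Xtt) mulr0 addr0.
have zIX : zeros IX = X.
  apply/seteqP; split=> [t [t0 It]|t Xtt].
    rewrite XE; split=> // f Ef; apply: It => s.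
    by rewrite XE => -[_]; apply.
  by split=> [|f]; [exact: Xt|apply].
by have [P [_ P0 PX Pgood]] := ideal_case IX IXI zIX; exists P.
Qed.
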